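(* For every $\eta\in\mathcal{H}_e$, consider the orthogonal decomposition $\eta=\langle\eta\rangle+P_{\mathcal{E}_0}\eta+P_{\mathcal{E}^\perp}\eta$ associated with $\mathcal{H}_e=\mathcal{U}_e\oplus\mathcal{E}_0\oplus\mathcal{E}^\perp$. Then the orthogonal projectors are expressed in terms of the Green's operators as $$P_{\mathcal{E}_0}=\Gamma_0L_0\qquad\text{and}\qquad P_{\mathcal{E}^\perp}=L_0^{-1}\Delta_0 .$$ Similarly, for every $\tau\in\mathcal{H}_s$, the orthogonal projectors in the decomposition $\tau=\langle\tau\rangle+P_{\mathcal{S}_0}\tau+P_{\mathcal{S}^\perp}\tau$ associated with $\mathcal{H}_s=\mathcal{U}_s\oplus\mathcal{S}_0\oplus\mathcal{S}^\perp$ are given by $$P_{\mathcal{S}_0}=\Delta_0L_0^{-1}\qquad\text{and}\qquad P_{\mathcal{S}^\perp}=L_0\Gamma_0 .$$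
   Context: Let $\mathcal{V}\subset\mathbb{R}^d$ be a unit cell that tiles $\mathbb{R}^d$ by translation along a lattice $\mathcal{R}$ generated by $d$ vectors. ''Periodic'' means $\mathcal{R}$-periodic. $L^2_{\mathrm{per}}(\mathcal{V})$ is the space of periodic functions in $L^2_{\mathrm{loc}}(\mathbb{R}^d)$, and $H^1_{\mathrm{per}}(\mathcal{V})$ the space of periodic functions in $H^1_{\mathrm{loc}}(\mathbb{R}^d)$. All fields are real-valued. Write $\langle f\rangle=\frac1{|\mathcal{V}|}\int_{\mathcal{V}}f\,dx$ and $s:e=\sum_{i,j}s_{ij}e_{ij}$. $L_0$ is a uniform (constant in $x$) positive definite fourth-order tensor with major and minor symmetries; it acts on second-order tensors, $(L_0\eta)_{ij}=\sum_{k,l}(L_0)_{ijkl}\eta_{kl}$, and it is thus an invertible, symmetric positive definite linear map on symmetric $d\times d$ matrices. $\mathcal{H}_e$ (strain fields) is the space of symmetric second-order tensor fields with components in $L^2_{\mathrm{per}}(\mathcal{V})$, with scalar product $(\eta,\tilde\eta)_{\mathcal{H}_e}=\langle L_0\eta:\tilde\eta\rangle$. $\mathcal{H}_s$ (stress fields) is the same set of tensor fields, with scalar product $(\tau,\tilde\tau)_{\mathcal{H}_s}=\langle\tau:L_0^{-1}\tilde\tau\rangle$. $\mathcal{U}_e\subset\mathcal{H}_e$ and $\mathcal{U}_s\subset\mathcal{H}_s$ are the subspaces of uniform (constant) fields. $\mathcal{E}_0=\{e^*\in\mathcal{H}_e:\ \exists\,w^*\in H^1_{\mathrm{per}}(\mathcal{V})^d,\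 e^*=\frac12(\nabla w^*+(\nabla w^* )^{\top})\}$ and $\mathcal{E}=\mathcal{U}_e\oplus\mathcal{E}_0$. $\mathcal{S}_0$ is the space of $s\in\mathcal{H}_s$ such that $\operatorname{div}s=0$ in $\mathcal{V}$, $s\cdot n$ is anti-periodic on $\partial\mathcal{V}$ ($n$ the unit outward normal), i.e. the periodic field $s$ is divergence-free on $\mathbb{R}^d$ in the sense of distributions, and $\langle s\rangle=0$. $\mathcal{S}=\mathcal{U}_s\oplus\mathcal{S}_0$. $\mathcal{E}^\perp$ is the orthogonal complement of $\mathcal{E}$ in $\mathcal{H}_e$ and $\mathcal{S}^\perp$ that of $\mathcal{S}$ in $\mathcal{H}_s$, each for the corresponding energetic scalar product. These give the orthogonal decompositions $\mathcal{H}_e=\mathcal{U}_e\oplus\mathcal{E}_0\oplus\mathcal{E}^\perp$ and $\mathcal{H}_s=\mathcal{U}_s\oplus\mathcal{S}_0\oplus\mathcal{S}^\perp$. $P_{\mathcal{E}_0},P_{\mathcal{E}^\perp}$ (in $\mathcal{H}_e$) and $P_{\mathcal{S}_0},P_{\mathcal{S}^\perp}$ (in $\mathcal{H}_s$) are the orthogonal projectors onto the indicated subspaces; the orthogonal projectors onto $\mathcal{U}_e$ and $\mathcal{U}_s$ are the averaging operator $\langle\cdot\rangle$. Green's operators: $\Gamma_0:\mathcal{H}_s\to\mathcal{H}_e$ is defined by $\Gamma_0\tau=e^*$, where $e^*$ is the unique element of $\mathcal{E}_0$ such that $L_0e^*-\tau\in\mathcal{S}$. $\Delta_0:\mathcal{H}_e\to\mathcal{H}_s$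 is defined by $\Delta_0\eta=s^*$, where $s^*$ is the unique element of $\mathcal{S}_0$ such that $L_0^{-1}s^*-\eta\in\mathcal{E}$. *)

(* Defs.v *)
From HB Require Import structures.
From mathcomp Require Import all_boot all_order all_algebra.
From mathcomp Require Import all_classical all_reals all_analysis.

Set Implicit Arguments.
Unset Strict Implicit.
Unset Printing Implicit Defensive.

Import Order.TTheory GRing.Theory Num.Theory.
Import numFieldNormedType.Exports.

Local Open Scope classical_set_scope.
Local Open Scope ring_scope.

(* R^d is 'rV[R]_d. The library provides its topology and derivatives, but no
   sigma-algebra; we use the one generated by the coordinate projections
   (i.e. the product Borel sigma-algebra). *)
Definition rV_display : measure_display -> measure_display.
Proof. exact. Qed.

Section measurable_rV.
Context (R : realType) (n : nat).

Let coor (i : 'I_n) (v : 'rV[R]_n) : measurableTypeR R := v ord0 i.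

Let rV_set0 : g_sigma_preimage coor set0.
Proof. exact: sigma_algebra0. Qed.

Let rV_setC A : g_sigma_preimage coor A -> g_sigma_preimage coor (~` A).
Proof. exact: sigma_algebraC. Qed.

Let rV_bigcup (F : _^nat) : (forall i, g_sigma_preimage coor (F i)) ->
  g_sigma_preimage coor (\bigcup_i (F i)).
Proof. exact: sigma_algebra_bigcup. Qed.

HB.instance Definition _ :=
  @isMeasurable.Build (rV_display (measure_tuple_display default_measure_display))
  'rV[R]_n (g_sigma_preimage coor) rV_set0 rV_setC rV_bigcup.

Lemma measurable_coor (i : 'I_n) :
  measurable_fun [set: 'rV[R]_n] (fun v => v ord0 i : measurableTypeR R).
Proof.
move=> _ Y mY; rewrite setTI; apply: sub_sigma_algebra => /=.
rewrite -bigcup_seq/=; exists i => /=; first by rewrite mem_index_enum.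
by exists Y => //; rewrite setTI.
Qed.

Lemma measurable_fun_coorP d (T : measurableType d) (f : T -> 'rV[R]_n) :
  (forall i, measurable_fun setT (fun x => f x ord0 i : measurableTypeR R)) ->
  measurable_fun setT f.
Proof.
move=> mf _ A mA; rewrite setTI; move: A mA.
suff : measurable `<=` [set A | measurable (f @^-1` A)] by [].
apply: smallest_sub.
  split => /=.
  - by rewrite preimage_set0.
  - by move=> A /= mA; rewrite setTD preimage_setC; exact: measurableC.
  - by move=> F /= mF; rewrite preimage_bigcup; exact: bigcup_measurable.
rewrite -bigcup_seq/= => A [i _ [B mB <-]] /=.
by rewrite setTI; have := mf i measurableT B mB; rewrite setTI.
Qed.

End measurable_rV.

Section lebesgue_rV.
Context (R : realType).

Definition rV_cons n (p : measurableTypeR R * 'rV[R]_n) : 'rV[R]_n.+1 :=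
  row_mx (const_mx p.1 : 'rV[R]_1) p.2.

Definition rV_uncons n (v : 'rV[R]_n.+1) : measurableTypeR R * 'rV[R]_n :=
  (v ord0 ord0, rsubmx (v : 'rV[R]_(1 + n))).

Lemma rV_consK n : cancel (@rV_cons n) (@rV_uncons n).
Proof.
move=> [a v]; congr (_, _); last exact: row_mxKr.
have -> : ord0 = lshift n (ord0 : 'I_1) by exact/val_inj.
by rewrite /rV_cons (row_mxEl (const_mx a : 'rV[R]_1)) mxE.
Qed.

Lemma rV_cons0 n (p : measurableTypeR R * 'rV[R]_n) :
  rV_cons p ord0 ord0 = p.1.
Proof. by rewrite -[in RHS](rV_consK p). Qed.

Lemma rV_consS n (p : measurableTypeR R * 'rV[R]_n) (i : 'I_n) :
  rV_cons p ord0 (lift ord0 i) = p.2 ord0 i.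
Proof.
have -> : lift ord0 i = rshift 1 i by exact/val_inj.
by rewrite /rV_cons (row_mxEr (const_mx p.1 : 'rV[R]_1)).
Qed.

Lemma measurable_rV_cons n : measurable_fun setT (@rV_cons n).
Proof.
apply: measurable_fun_coorP => i.
have [j ->|->] := fintype.unliftP ord0 i.
- have -> : (fun p => rV_cons p ord0 (lift ord0 j)) =
            (fun v : 'rV[R]_n => v ord0 j) \o snd.
    by apply/funext => p; rewrite rV_consS.
  by apply: measurableT_comp; [exact: measurable_coor|exact: measurable_snd].
- have -> : (fun p : measurableTypeR R * 'rV[R]_n =>
               rV_cons p ord0 ord0 : measurableTypeR R) = fst.
    by apply/funext => p; rewrite rV_cons0.
  exact: measurable_fst.
Qed.

Lemma measurable_rV_uncons n : measurable_fun setT (@rV_uncons n).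
Proof.
apply/measurable_fun_pairP; split; first exact: measurable_coor.
apply: measurable_fun_coorP => i /=.
have -> : (fun v : 'rV[R]_n.+1 => rsubmx (v : 'rV[R]_(1 + n)) ord0 i) =
          (fun v => v ord0 (lift ord0 i)).
  by apply/funext => v; rewrite mxE; congr (v _ _); exact/val_inj.
exact: measurable_coor.
Qed.

HB.instance Definition _ n := isMeasurableFun.Build _ _ _ _
  (@rV_cons n) (@measurable_rV_cons n).

Section lebesgue_rV_step.
Local Open Scope ereal_scope.
Context (n : nat) (m : {sigma_finite_measure set 'rV[R]_n -> \bar R}).

Definition lebesgue_rV_step : set 'rV[R]_n.+1 -> \bar R :=
  pushforward (lebesgue_measure \x m) (@rV_cons n).

Let step0 : lebesgue_rV_step set0 = 0.
Proof. exact: measure0. Qed.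

Let step_ge0 A : 0 <= lebesgue_rV_step A.
Proof. exact: measure_ge0. Qed.

Let step_sigma_additive : semi_sigma_additive lebesgue_rV_step.
Proof. exact: measure_semi_sigma_additive. Qed.

HB.instance Definition _ := isMeasure.Build _ _ _ lebesgue_rV_step
  step0 step_ge0 step_sigma_additive.

(* Not derivable by canonical inference: the instance found for the product
   measure is the one that requires both factors to be finite. *)
Let step_sigma_finite : sigma_finite setT lebesgue_rV_step.
Proof.
have /sigma_finiteP[F [TF ndF Foo]] := sigma_finiteT (@lebesgue_measure R).
have /sigma_finiteP[G [TG ndG Goo]] := sigma_finiteT m.
have mFG k : measurable (F k `*` G k).
  by apply: measurableX; [exact: (Foo k).1|exact: (Goo k).1].
exists (fun k => @rV_uncons n @^-1` (F k `*` G k)).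
  rewrite -preimage_bigcup -[LHS](@preimage_setT _ _ (@rV_uncons n)).
  congr (_ @^-1` _); apply/esym/seteqP; split => // -[x y] _.
  have [i _ Fix] : (\bigcup_i F i) x by rewrite -TF.
  have [j _ Gjy] : (\bigcup_i G i) y by rewrite -TG.
  exists (maxn i j) => //; split.
  - by move: x Fix; exact/subsetPset/ndF/leq_maxl.
  - by move: y Gjy; exact/subsetPset/ndG/leq_maxr.
move=> k; have [? Fk] := Foo k; have [? Gk] := Goo k; split.
  by rewrite -[X in measurable X]setTI; exact: measurable_rV_uncons.
rewrite /lebesgue_rV_step /pushforward -comp_preimage.
have -> : @rV_uncons n \o @rV_cons n = id by apply/funext => p; exact: rV_consK.
by rewrite preimage_id product_measure1E// lte_mul_pinfty// ge0_fin_numE.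
Qed.

HB.instance Definition _ := Measure_isSigmaFinite.Build _ _ _ lebesgue_rV_step
  step_sigma_finite.

End lebesgue_rV_step.

Fixpoint lebesgue_rV n : {sigma_finite_measure set 'rV[R]_n -> \bar R} :=
  match n with
  | 0 => (\d_(0 : 'rV[R]_0))%R
  | n.+1 => lebesgue_rV_step (lebesgue_rV n)
  end.

Lemma lebesgue_rV_box n (A : 'I_n -> set (measurableTypeR R)) :
  (forall i, measurable (A i)) ->
  lebesgue_rV n [set v | forall i, A i (v ord0 i)] =
  (\prod_(i < n) lebesgue_measure (A i))%E.
Proof.
elim: n A => [|n IHn] A mA.
  by rewrite big_ord0 /= diracE mem_set// => -[].
set B := [set v : 'rV[R]_n | forall i, A (lift ord0 i) (v ord0 i)].
have mB : measurable B.
  have -> : B = \bigcap_i [set v : 'rV[R]_n | A (lift ord0 i) (v ord0 i)].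
    by apply/seteqP; split => v /= Av i; [move=> _|]; exact: Av.
  apply: fin_bigcap_measurable => // i _.
  by rewrite -[X in measurable X]setTI; exact: measurable_coor.
rewrite big_ord_recl -(IHn (A \o lift ord0)) => [|i]; last exact: mA.
rewrite -[RHS]product_measure1E//.
rewrite /= /lebesgue_rV_step /pushforward; congr (_ _).
apply/seteqP; split => p /= => [Ap|[Ap1 Ap2] i].
  split; first by rewrite -rV_cons0.
  by move=> i; rewrite -rV_consS.
have [j ->|->] := fintype.unliftP ord0 i; first by rewrite rV_consS.
by rewrite rV_cons0.
Qed.

End lebesgue_rV.

Section periodic_spaces.
Context (R : realType) (d : nat).
Local Notation Rd := 'rV[R]_d.
Local Notation mu := (lebesgue_rV R d).
Implicit Types (B : 'M[R]_d) (V : set Rd) (f g phi : Rd -> R).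

(* The lattice is generated by the rows of B. *)
Definition lattice_vec B (z : 'rV[int]_d) : Rd := map_mx intr z *m B.

Definition translate V (r : Rd) : set Rd := [set x + r | x in V].

(* The translates of V along the lattice cover R^d and do not overlap, both up
   to Lebesgue-null sets: open, closed and half-open cells are all allowed. *)
Definition unit_cell B V :=
  [/\ measurable V,
      mu (~` \bigcup_z translate V (lattice_vec B z)) = 0%E &
      forall z : 'rV[int]_d, z != 0 ->
        mu (V `&` translate V (lattice_vec B z)) = 0%E].

(* Elements of Lebesgue spaces are represented by measurable functions, and
   identified when they are equal almost everywhere. *)
Definition periodic B f :=
  forall z, (fun x => f (x + lattice_vec B z)) = f %[ae mu].

Definition L2loc f :=
  measurable_fun setT f /\
  forall K : set Rd, compact K -> (\int[mu]_(x in K) (f x ^+ 2)%:E < +oo)%E.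

Definition L2per B f := L2loc f /\ periodic B f.

Definition partial (j : 'I_d) phi : Rd -> R := 'D_(delta_mx 0 j) phi.

Fixpoint Ck (k : nat) phi : Prop :=
  match k with
  | 0 => continuous phi
  | k.+1 => continuous phi /\ forall j : 'I_d,
      (forall x, derivable phi x (delta_mx 0 j)) /\ Ck k (partial j phi)
  end.

Definition test_function phi :=
  (forall k, Ck k phi) /\ compact (closure [set x | phi x != 0]).

Definition weak_partial (j : 'I_d) f g :=
  forall phi, test_function phi ->
  \int[mu]_x (f x * partial j phi x) = - \int[mu]_x (g x * phi x).

Definition H1loc f :=
  L2loc f /\ forall j, exists2 g, L2loc g & weak_partial j f g.

Definition H1per B f := H1loc f /\ periodic B f.

Definition average V f : R := (fine (mu V))^-1 * \int[mu]_(x in V) f x.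

End periodic_spaces.

Section tensors.
Context (R : realType) (d : nat).

Definition tensor4 := 'I_d -> 'I_d -> 'I_d -> 'I_d -> R.

Implicit Types (L : tensor4) (e s : 'M[R]_d).

Definition symmetric e := e^T = e.

Definition ddot s e : R := \sum_i \sum_j s i j * e i j.

Definition tensor_app L e : 'M[R]_d :=
  \matrix_(i, j) \sum_k \sum_l L i j k l * e k l.

Definition minor_symmetries L :=
  forall i j k l, L i j k l = L j i k l /\ L i j k l = L i j l k.

Definition major_symmetry L := forall i j k l, L i j k l = L k l i j.

Definition positive_definite L :=
  forall e, symmetric e -> e != 0 -> 0 < ddot (tensor_app L e) e.

(* The inverse of L as a linear map of the space of symmetric matrices; the
   default value 0 is only used outside that space. *)
Definition tensor_inv L s : 'M[R]_d :=
  xget 0 [set e | symmetric e /\ tensor_app L e = s].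

End tensors.

Section fields.
Context (R : realType) (d : nat).
Local Notation Rd := 'rV[R]_d.
Local Notation mu := (lebesgue_rV R d).

Definition field := Rd -> 'M[R]_d.

Context (B : 'M[R]_d) (V : set Rd) (L : tensor4 R d).
Implicit Types (u e s eta tau : field) (U W : set field).

(* The common underlying set of H_e and H_s, which differ only by their scalar
   products ip_e and ip_s below. *)
Definition sym_fields : set field :=
  [set eta | (forall x, symmetric (eta x)) /\
             forall i j, L2per B (fun x => eta x i j)].

Definition field_app eta : field := fun x => tensor_app L (eta x).
Definition field_inv tau : field := fun x => tensor_inv L (tau x).

Definition ip_e eta eta' : R :=
  average V (fun x => ddot (field_app eta x) (eta' x)).
Definition ip_s tau tau' : R :=
  average V (fun x => ddot (tau x) (field_inv tau' x)).

Definition mean eta : field :=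
  fun=> \matrix_(i, j) average V (fun x => eta x i j).

Definition uniform : set field :=
  [set u | sym_fields u /\ exists c : 'M[R]_d, u = (fun=> c) %[ae mu]].

Definition sum_fields U W : set field :=
  [set (fun x => u x + w x) | u in U & w in W].

(* G i j is the weak derivative of the i-th component of w along the j-th
   axis. *)
Definition E0 : set field :=
  [set e | sym_fields e /\
    exists (w : 'I_d -> Rd -> R) (G : 'I_d -> 'I_d -> Rd -> R),
    [/\ forall i, H1per B (w i),
        forall i j, L2loc (G i j) /\ weak_partial j (w i) (G i j) &
        e = (fun x => \matrix_(i, j) (2^-1 * (G i j x + G j i x))) %[ae mu]]].

Definition E : set field := sum_fields uniform E0.

(* div s = 0 on the whole of R^d in the sense of distributions, which encodes
   both div s = 0 inside V and the anti-periodicity of s.n on its boundary *)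
Definition div_free s :=
  forall (i : 'I_d) (phi : Rd -> R), test_function phi ->
  \sum_j \int[mu]_x (s x i j * partial j phi x) = 0.

Definition S0 : set field :=
  [set s | [/\ sym_fields s, div_free s & mean s = (fun=> 0)]].

Definition S : set field := sum_fields uniform S0.

Definition orthogonal_complement (ip : field -> field -> R) W : set field :=
  [set eta | sym_fields eta /\ forall w, W w -> ip eta w = 0].

Definition E_perp : set field := orthogonal_complement ip_e E.
Definition S_perp : set field := orthogonal_complement ip_s S.

Definition orthogonal_projector (ip : field -> field -> R) W
    (P : field -> field) :=
  forall eta, sym_fields eta ->
  W (P eta) /\ forall w, W w -> ip (fun x => eta x - P eta x) w = 0.

(* The Green's operators are introduced by their defining property: their value
   is the unique solution (up to a.e. equality) of the auxiliary problem. *)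
Definition strain_green_operator (Gamma : field -> field) :=
  forall tau, sym_fields tau ->
  let solves e := E0 e /\ S (fun x => field_app e x - tau x) in
  solves (Gamma tau) /\ forall e, solves e -> e = Gamma tau %[ae mu].

Definition stress_green_operator (Delta : field -> field) :=
  forall eta, sym_fields eta ->
  let solves s := S0 s /\ E (fun x => field_inv s x - eta x) in
  solves (Delta eta) /\ forall s, solves s -> s = Delta eta %[ae mu].

End fields.

(* Main.v *)
From HB Require Import structures.
Require Import Defs.
From mathcomp Require Import all_boot all_order all_algebra.
From mathcomp Require Import all_classical all_reals all_analysis.
From mathcomp Require Import measurable_realfun ring lra.
Import Order.TTheory GRing.Theory Num.Theory.
Import numFieldNormedType.Exports.
Local Open Scope classical_set_scope.
Local Open Scope ring_scope.

(** Write [pairing V s e] for the cell average of s : e, and L for [L0].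

    The four formulas are consequences of Hill's lemma: a stress field of S and
    a strain field of E0 have zero pairing. Together with the fact that a
    uniform field has zero pairing with a field of zero mean, it makes
    L^-1 S0 orthogonal to E and L E0 orthogonal to S. So, for instance, the
    condition L^-1 (Delta0 eta) - eta \in E that defines Delta0 writes eta as
    a field of E plus the field L^-1 (Delta0 eta) of E_perp, and such a
    splitting identifies the projection; the three other formulas are obtained
    in the same way. The sum of the three projections is eta because the
    remainder belongs to E_perp and is orthogonal to E and to E_perp, so that
    its energy vanishes, and the energy is definite.

    Hill's lemma ([hill_lemma]) is usually proved by approximating an H^1
    displacement by smooth ones. Here the existence of the projector onto E0
    and the uniqueness in the definition of Gamma0 leave only the opposite
    implication to prove ([S_of_orthogonal]): a symmetric field s whose pairing
    with every field of E0 vanishes belongs to S. Indeed, given s in S, let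
    tau = - s and let p be the projection onto E0 of L^-1 tau. Then L p - tau
    has zero pairing with E0, so it belongs to S, and p solves the problem that
    defines Gamma0 tau. But 0 solves it too, because - tau = s is in S. By
    uniqueness p = 0 almost everywhere, which says that s has zero pairing with
    E0.

    That implication involves smooth displacements only. For a test function
    phi, the periodization P phi (x) = \sum_z phi (x + z), over the lattice
    vectors z, is a smooth periodic function whose derivatives are the
    periodizations of those of phi. Taking the displacement P phi in direction
    i gives \sum_j \int_V s_ij P (d_j phi) = 0, and the integral over the cell
    unfolds to \sum_j \int_{R^d} s_ij d_j phi = 0, because s is periodic and
    the translates of V tile the space ([integral_periodic_mul]): this is
    div s = 0. What remains is measure theory on R^d: continuous functions are
    measurable, the Lebesgue measure is invariant by translation, derivatives
    of compactly supported functions have zero integral, and an integral over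
    R^d unfolds to the cell ([unfold_ge0]). *)

Set Implicit Arguments.
Unset Strict Implicit.
Unset Printing Implicit Defensive.

(** * Measurability of continuous functions on R^d *)

Section lebesgue_measure_on_Rd.
Context (R : realType).

Let box_ball n (q : 'rV[rat]_n) (k : nat) : set 'rV[R]_n :=
  [set v | forall i, `|ratr (q ord0 i) - v ord0 i| < k.+1%:R^-1].

Let measurable_box_ball n (q : 'rV[rat]_n) k : measurable (box_ball q k).
Proof.
have -> : box_ball q k = \bigcap_(i in [set: 'I_n])
    (fun v : 'rV[R]_n => v ord0 i) @^-1`
    [set t : measurableTypeR R | `|ratr (q ord0 i) - t| < k.+1%:R^-1].
  by apply/seteqP; split => v qv i; [move=> _|]; exact: qv.
apply: fin_bigcap_measurable => // i _.
rewrite -[X in measurable X]setTI; apply: measurable_coor => //.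
by apply: open_measurable; exact: (@ball_open R R (ratr (q ord0 i))).
Qed.

(** The sigma-algebra is generated by the coordinates, so open sets are reached
    through the countable family of cubes with rational center and radius
    1/(k+1), for the maximum norm. *)
Lemma open_measurable_rV n (U : set 'rV[R]_n) : open U -> measurable U.
Proof.
move=> oU.
pose F (p : 'rV[rat]_n * nat) :=
  if pselect (box_ball p.1 p.2 `<=` U) then box_ball p.1 p.2 else set0.
suff -> : U = \bigcup_p F p.
  apply: countable_bigcupT_measurable => [|p]; first exact: countableP.
  by rewrite /F; case: pselect => //= _; exact: measurable_box_ball.
apply/seteqP; split => [x Ux|x [p _]]; last first.
  by rewrite /F; case: pselect => //= pU; exact: pU.
have /nbhs_ballP[e /= e0 xeU] := open_nbhs_nbhs (conj oU Ux).
(* half of e: the rational center q is only close to x, and the cube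
   around q has to fit in the ball around x *)
have [k ke] : exists k : nat, k.+1%:R^-1 < e / 2.
  have e20 : 0 < e / 2 by rewrite divr_gt0.
  have [k _ /(_ k (leqnn _))] := near_infty_natSinv_lt (PosNum e20).
  by exists k.
have q_ i : exists q : rat, `|ratr q - x ord0 i| < k.+1%:R^-1.
  have [|q] := @rat_in_itvoo R (x ord0 i - k.+1%:R^-1) (x ord0 i + k.+1%:R^-1).
    by rewrite ltrBlDr -addrA ltrDl -mulr2n mulrn_wgt0// invr_gt0.
  by rewrite in_itv/= -ltr_distl; exists q.
pose q : 'rV[rat]_n := \row_i xchoose (q_ i).
have qx : box_ball q k x by move=> i; rewrite mxE; exact: (xchooseP (q_ i)).
exists (q, k) => //; rewrite /F; case: pselect => //= -[] v qv.
apply: xeU; split => // i j; rewrite ord1 /ball/=.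
rewrite -(subrKA (ratr (q ord0 j))) (le_lt_trans (ler_normD _ _))// distrC.
by rewrite [ltRHS]splitr; apply: ltrD; apply: lt_trans ke; [exact: qx|exact: qv].
Qed.

Lemma continuous_measurable_rV n (f : 'rV[R]_n -> R) :
  continuous f -> measurable_fun setT f.
Proof.
move=> /continuousP cf.
apply: (measurability _ (RGenOpens.measurableE R)).
move=> _ [_ [a [b ->] <-]]; rewrite setTI.
by apply: open_measurable_rV; apply: cf; exact: interval_open.
Qed.

End lebesgue_measure_on_Rd.

(** * Translation invariance of the Lebesgue measure *)

Section translation.
Context (R : realType).

Lemma lebesgue_measure_translate (r : R) (A : set R) : measurable A ->
  lebesgue_measure ((fun t => t + r) @^-1` A) = lebesgue_measure A.
Proof.
move=> mA; apply/esym.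
have mr : measurable_fun [set: measurableTypeR R]
    (fun t => t + r : measurableTypeR R) by exact: measurable_funD.
apply: (@lebesgue_measure_unique R
  (pushforward lebesgue_measure
    (fun t : measurableTypeR R => t + r : measurableTypeR R))) => //= _ [[a b]] _ <-.
rewrite /pushforward/=.
have -> : (fun t => t + r) @^-1` `]a, b] = `]a - r, b - r]%classic.
  by apply/seteqP; split => t /=; rewrite !in_itv/= ltrBlDr lerBrDr.
rewrite !lebesgue_measure_itv/= !lte_fin ltrD2r -!EFinB.
by case: ifPn => // _; congr (_%:E); rewrite opprB addrA subrK.
Qed.

Lemma ge0_integral_translate (r : R) (f : R -> \bar R) :
  measurable_fun setT f -> (forall t, 0 <= f t)%E ->
  (\int[lebesgue_measure]_t f (t + r)%R = \int[lebesgue_measure]_t f t)%E.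
Proof.
move=> mf f0.
have mr : measurable_fun [set: measurableTypeR R]
    (fun t => t + r : measurableTypeR R) by exact: measurable_funD.
rewrite -[LHS](@ge0_integral_pushforward _ _ (measurableTypeR R) (measurableTypeR R)
  R (fun t => t + r : measurableTypeR R) mr lebesgue_measure setT f)//.
by apply: eq_measure_integral => A mA _; exact: lebesgue_measure_translate.
Qed.

Lemma measurable_translate n (r : 'rV[R]_n) :
  measurable_fun setT (fun x : 'rV[R]_n => x + r).
Proof.
apply: measurable_fun_coorP => i.
under eq_fun do rewrite mxE.
by apply: measurable_funD; [exact: measurable_coor|exact: measurable_cst].
Qed.

(** By induction on n, through the sections of A: the translation of the last
    coordinates is absorbed by the induction hypothesis, that of the first one
    by the invariance of the one-dimensional integral. *)
Lemma lebesgue_rV_translate n (r : 'rV[R]_n) (A : set 'rV[R]_n) :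
  measurable A ->
  lebesgue_rV R n ((fun x => x + r) @^-1` A) = lebesgue_rV R n A.
Proof.
elim: n r A => [|n IHn] r A mA.
  by congr (_ _); apply/seteqP; split => x /=; rewrite (thinmx0 x) (thinmx0 (_ + r)).
pose A' := @rV_cons R n @^-1` A.
have mA' : measurable A'.
  by rewrite -[X in measurable X]setTI; exact: measurable_rV_cons.
pose r' := rV_uncons r.
rewrite /= /lebesgue_rV_step /pushforward /product_measure1 -/A'.
transitivity (\int[@lebesgue_measure R]_t
    (lebesgue_rV R n \o xsection A') (t + r'.1)%R)%E.
  apply: eq_integral => t _ /=.
  rewrite -[RHS](IHn r'.2); last first.
    exact: (measurable_xsection (t + r'.1 : measurableTypeR R) mA').
  congr (_ _); rewrite /xsection /A'; apply/seteqP.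
  suff E y : rV_cons (t, y) + r = rV_cons (t + r'.1, y + r'.2).
    by split => y; rewrite /= !inE/= E.
  apply/rowP => i; rewrite mxE; have [j ->|->] := fintype.unliftP ord0 i.
    rewrite !rV_consS/= !mxE; congr (_ + r _ _); exact/val_inj.
  by rewrite !rV_cons0.
apply: ge0_integral_translate => [|t]; last exact: measure_ge0.
exact: measurable_fun_xsection mA'.
Qed.

End translation.

Section integral_translation.
Context (R : realType) (n : nat).
Local Notation Rn := 'rV[R]_n.
Local Notation mu := (lebesgue_rV R n).

Lemma ge0_integral_translate_rV (r : Rn) (f : Rn -> \bar R) :
  measurable_fun setT f -> (forall x, 0 <= f x)%E ->
  (\int[mu]_x f (x + r)%R = \int[mu]_x f x)%E.
Proof.
move=> mf f0.
rewrite -[LHS](@ge0_integral_pushforward _ _ _ _ R (fun x : Rn => x + r)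
  (measurable_translate r) mu setT f)//.
apply: eq_measure_integral; first exact: measurable_translate.
by move=> ? A mA _; exact: (lebesgue_rV_translate r mA).
Qed.

Lemma Rintegral_translate_rV (r : Rn) (f : Rn -> R) :
  measurable_fun setT f -> \int[mu]_x f (x + r) = \int[mu]_x f x.
Proof.
move=> mf; congr fine; have mEf : measurable_fun setT (EFin \o f).
  exact/measurable_EFinP.
rewrite [LHS]integralE [RHS]integralE; congr (_ - _)%E.
- rewrite -[RHS](ge0_integral_translate_rV r (measurable_funepos mEf)) => [|x].
    by apply: eq_integral => x _; rewrite ?funeposE ?funenegE.
  by rewrite ?funeposE ?funenegE le_max lexx orbT.
- rewrite -[RHS](ge0_integral_translate_rV r (measurable_funeneg mEf)) => [|x].
    by apply: eq_integral => x _; rewrite ?funeposE ?funenegE.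
  by rewrite ?funeposE ?funenegE le_max lexx orbT.
Qed.

(** The norm of ['rV[R]_n] is the maximum norm, so these balls are cubes, whose
    measure is a finite product. *)
Definition cube (M : R) : set Rn := [set x | `|x| <= M].

Lemma coor_le_norm (x : Rn) i : `|x ord0 i| <= `|x|.
Proof.
rewrite [leRHS]mx_normrE.
exact: (le_bigmax _ (fun ij : 'I_1 * 'I_n => `|x ij.1 ij.2|) (ord0, i)).
Qed.

Lemma norm_rV_le (x : Rn) M : 0 <= M ->
  (forall i, `|x ord0 i| <= M) -> `|x| <= M.
Proof.
move=> M0 xM; rewrite [leLHS]mx_normrE; apply: bigmax_le => // -[i j] _.
by rewrite ord1.
Qed.

Lemma closed_cube M : closed (cube M).
Proof.
apply: (@closed_comp _ _ (fun x : Rn => `|x|) [set t | t <= M]) => [x _|].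
  exact: norm_continuous.
exact: closed_le.
Qed.

Lemma compact_cube M : compact (cube M).
Proof.
apply: bounded_closed_compact; last exact: closed_cube.
by exists M; split => //; [exact: num_real|move=> N MN x /le_trans; apply; exact: ltW].
Qed.

Lemma measurable_cube M : measurable (cube M).
Proof.
rewrite -[cube M]setCK; apply: measurableC; apply: open_measurable_rV.
exact/closed_openC/closed_cube.
Qed.

Lemma measurable_box (I : set (measurableTypeR R)) : measurable I ->
  measurable [set v : Rn | forall i, I (v ord0 i)].
Proof.
move=> mI; have -> : [set v : Rn | forall i, I (v ord0 i)] =
    \bigcap_i [set v : Rn | I (v ord0 i)].
  by apply/seteqP; split => v Av i; [move=> _|]; exact: Av.
apply: fin_bigcap_measurable => // i _.
by rewrite -[X in measurable X]setTI; exact: measurable_coor.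
Qed.

Lemma lebesgue_cube_lty M : (mu (cube M) < +oo)%E.
Proof.
pose I := `[- M, M]%classic : set (measurableTypeR R).
have mI : measurable I by exact: measurable_itv.
have sub : cube M `<=` [set v | forall i, I (v ord0 i)].
  move=> x xM i; rewrite /I/= in_itv/= -ler_norml.
  exact: le_trans (coor_le_norm x i) xM.
apply: le_lt_trans (le_measure mu _ _ sub) _; rewrite ?inE//.
- exact: measurable_cube.
- exact: measurable_box.
rewrite [X in (X < _)%E](_ : _ = (\prod_(i < n) lebesgue_measure I)%E); last first.
  exact: lebesgue_rV_box (fun=> mI).
have I0 : (0 <= lebesgue_measure I)%E by [].
have Ioo : (lebesgue_measure I < +oo)%E.
  by rewrite /I lebesgue_measure_itv/=; case: ifPn => //; rewrite -EFinB ltry.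
suff /andP[] : (0 <= \prod_(i < n) lebesgue_measure I < +oo)%E by [].
elim/big_ind : _ => [|x y /andP[x0 xoo] /andP[y0 yoo]|_ _]; last by rewrite I0 Ioo.
  by rewrite lee01 ltry.
by rewrite mule_ge0//= lte_mul_pinfty// ge0_fin_numE.
Qed.

Lemma lebesgue_setT_gt0 : (0 < mu setT)%E.
Proof.
pose I := `[0, 1]%classic : set (measurableTypeR R).
have mI : measurable I by exact: measurable_itv.
apply: (@lt_le_trans _ _ (mu [set v | forall i, I (v ord0 i)])); last first.
  by apply: le_measure; rewrite ?inE//; exact: measurable_box.
rewrite [X in (_ < X)%E](_ : _ = (\prod_(i < n) lebesgue_measure I)%E); last first.
  exact: lebesgue_rV_box (fun=> mI).
rewrite big1// => i _.
by rewrite /I lebesgue_measure_itv/= lte_fin ltr01 -EFinB subr0.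
Qed.

End integral_translation.

(** * Integration by parts for compactly supported functions *)

Section integration_by_parts.
Context (R : realType) (n : nat).
Local Notation Rn := 'rV[R]_n.
Local Notation mu := (lebesgue_rV R n).
Implicit Types (f g psi : Rn -> R) (j : 'I_n).

Definition supported_in_cube (M : R) f := forall x, M < `|x| -> f x = 0.

Lemma integrable_bounded_supported (M C : R) f : measurable_fun setT f ->
  supported_in_cube M f -> (forall x, `|f x| <= C) ->
  mu.-integrable setT (EFin \o f).
Proof.
move=> mf fM fC.
have iC : mu.-integrable setT (EFin \o (fun x : Rn => C * \1_(@cube R n M) x)).
  have mC : measurable_fun setT (fun x : Rn => C * \1_(@cube R n M) x).
    by apply: measurable_funM => //; apply: measurable_indic; exact: measurable_cube.
  have C0 : 0 <= C by exact: le_trans (normr_ge0 _) (fC 0).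
  apply/integrableP; split; first exact/measurable_EFinP.
  under eq_integral do rewrite /= normrM (ger0_norm C0) ger0_norm// EFinM.
  rewrite ge0_integralZl//; last first.
    by apply/measurable_EFinP/measurable_indic; exact: measurable_cube.
  rewrite integral_indic ?setIT//; last exact: measurable_cube.
  apply: lte_mul_pinfty; rewrite ?lee_fin//; exact: lebesgue_cube_lty.
apply: le_integrable iC => //; first exact/measurable_EFinP.
move=> x _ /=; rewrite lee_fin indicE; case: (boolP (x \in cube M)) => [_|].
  by rewrite mulr1 (le_trans (fC x))// ler_norm.
by rewrite notin_setE /cube/= => /negP; rewrite -ltNge => /fM ->; rewrite normr0.
Qed.

Lemma continuous_bounded_on_cube (M : R) f : continuous f ->
  exists C, forall x, `|x| <= M -> `|f x| <= C.
Proof.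
move=> cf.
have : compact (f @` cube M).
  by apply: continuous_compact; [exact: continuous_subspaceT|exact: compact_cube].
move=> /compact_bounded[C [_ Cf]].
exists (C + 1) => x xM; apply: (Cf (C + 1)); first by rewrite ltrDl.
by exists x.
Qed.

Lemma continuous_supported_bounded (M : R) f : continuous f ->
  supported_in_cube M f -> exists C, forall x, `|f x| <= C.
Proof.
move=> cf fM; have [C Cf] := continuous_bounded_on_cube M cf.
exists `|C| => x; have [xM|/fM ->] := leP `|x| M; last by rewrite normr0.
by rewrite (le_trans (Cf x xM))// ler_norm.
Qed.

Lemma integrable_continuous_supported (M : R) f : continuous f ->
  supported_in_cube M f -> mu.-integrable setT (EFin \o f).
Proof.
move=> cf fM; have [C Cf] := continuous_supported_bounded cf fM.
by apply: integrable_bounded_supported fM Cf; exact: continuous_measurable_rV.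
Qed.

Lemma supported_partial (M : R) j f :
  supported_in_cube M f -> supported_in_cube M (partial j f).
Proof.
move=> fM x Mx; rewrite /partial.
have : \forall y \near x, f y = cst 0 y.
  suff : \forall y \near x, M < `|y| by apply: filterS => y; exact: fM.
  exact: (@cvgr_gt _ _ _ _ (fun y : Rn => `|y|) `|x| (@norm_continuous _ _ x) M Mx).
by move=> /near_eq_derive ->//; rewrite derive_cst.
Qed.

(** The difference quotients of the restriction to a line are those of f. *)
Lemma derive_along_line f (x v : Rn) (t : R) :
  (derivable f (x + t *: v) v -> derivable (fun s : R => f (x + s *: v)) t 1) /\
  'D_1 (fun s : R => f (x + s *: v)) t = 'D_v f (x + t *: v).
Proof.
have E : (fun h : R => h^-1 *: ((((fun s : R => f (x + s *: v)) \o shift t) (h *: 1)) -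
          f (x + t *: v))) =
         (fun h : R => h^-1 *: ((f \o shift (x + t *: v)) (h *: v) - f (x + t *: v))).
  apply/funext => h /=; congr (_ *: (f _ - _)).
  by rewrite scaler1 scalerDl addrCA addrA addrC.
by split; rewrite /derivable /derive E.
Qed.

(** The integral of f (x + t e_j) does not depend on t, by translation
    invariance; its derivative at t = 0, computed under the integral sign, is
    the integral of the partial derivative. *)
Lemma Rintegral_partial_eq0 (M : R) j f : Ck 1 f -> supported_in_cube M f ->
  \int[mu]_x partial j f x = 0.
Proof.
move=> [cf /(_ j)[df cdf]] fM.
have [C Cf] := continuous_supported_bounded cdf (supported_partial j fM).
pose e : Rn := delta_mx 0 j.
pose F (t : R) (x : Rn) := f (x + t *: e).
(* domination for |t| < 1: the translates of the support of f by t e all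
   lie in the cube of radius M + |e| *)
pose G (x : Rn) := C * \1_(@cube R n (M + `|e|)) x.
have mG : measurable_fun setT G.
  by apply: measurable_funM => //; apply: measurable_indic; exact: measurable_cube.
have C0 : 0 <= C by exact: le_trans (normr_ge0 _) (Cf 0).
have far (w x : Rn) : M + `|w| < `|x| -> M < `|x + w|.
  move=> Mx; rewrite -(ltrD2r `|w|) (lt_le_trans Mx)//.
  by rewrite -[x in leLHS](addrK w) (le_trans (ler_normB _ _)).
have Ioo (t : R) : `]-1, 1[%classic t -> `|t| <= 1.
  by rewrite /= in_itv/= -ltr_norml => /ltW.
have dF (t : R) x : 'D_1 (F ^~ x) t = partial j f (x + t *: e).
  exact: (derive_along_line f x e t).2.
have mF t : measurable_fun setT (F t).
  apply: (measurableT_comp (continuous_measurable_rV cf)).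
  exact: measurable_translate.
have intF t : mu.-integrable setT (EFin \o F t).
  have [K Kf] := continuous_supported_bounded cf fM.
  apply: (@integrable_bounded_supported (M + `|t *: e|) K) => // [x Mx|x].
    by apply: fM; exact: far.
  exact: Kf.
have := @differentiation_under_integral R _ _ mu F setT measurableT 0 (-1) 1 _ _ _ G.
rewrite (_ : (fun t : R => _) = cst (\int[mu]_x f x)); last first.
  apply/funext => t; rewrite /F/=.
  by apply: Rintegral_translate_rV; exact: continuous_measurable_rV.
rewrite derive1_cst.
move=> H; rewrite [RHS]H.
- by apply: eq_Rintegral => x _; rewrite partial1of2E dF scale0r addr0.
- by rewrite /= in_itv/= ltrN10 ltr01.
- by move=> t _; exact: intF.
- by move=> t x _ _; apply: (derive_along_line f x e t).1; exact: df.
- by move=> x; rewrite mulr_ge0.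
- apply: (@integrable_bounded_supported (M + `|e|) C) => // x.
    rewrite /G indicE => Mx; rewrite memNset ?mulr0// /cube/=.
    by apply/negP; rewrite -ltNge.
  by rewrite /G indicE normrM (ger0_norm C0) ler_piMr// normr_nat; case: (_ \in _).
- move=> t x /Ioo t1 _; rewrite partial1of2E dF /G indicE.
  have [|Mx] := leP `|x| (M + `|e|) => [xM|].
    by rewrite mem_set// mulr1.
  rewrite (supported_partial j fM) ?normr0 ?mulr_ge0//.
  apply: far; apply: le_lt_trans Mx; rewrite lerD2l normrZ.
  by rewrite ler_piMl.
Qed.

Lemma continuousM_rV f g :
  continuous f -> continuous g -> continuous (fun x => f x * g x).
Proof. by move=> cf cg x; apply: continuousM; [exact: cf|exact: cg]. Qed.

Lemma partialM j f g : Ck 1 f -> Ck 1 g ->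
  partial j (f * g) = (fun x => f x * partial j g x + partial j f x * g x).
Proof.
move=> f1 g1; apply/funext => x; rewrite /partial deriveM.
- by congr (_ + _); exact: mulrC.
- exact: (f1.2 j).1.
- exact: (g1.2 j).1.
Qed.

Lemma integration_by_parts_rV (M : R) j f psi : Ck 1 f -> Ck 1 psi ->
  supported_in_cube M psi ->
  \int[mu]_x (f x * partial j psi x) = - \int[mu]_x (partial j f x * psi x).
Proof.
move=> f1 psi1 psiM.
have cl k : continuous (fun x => f x * partial k psi x).
  by apply: continuousM_rV; [exact: f1.1|exact: (psi1.2 k).2].
have cr k : continuous (fun x => partial k f x * psi x).
  by apply: continuousM_rV; [exact: (f1.2 k).2|exact: psi1.1].
apply/eqP; rewrite -addr_eq0 -RintegralD//.
- have := @Rintegral_partial_eq0 M j (f * psi).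
  rewrite partialM// => -> //.
    split; first exact: continuousM_rV f1.1 psi1.1.
    move=> k; split => [x|].
      by apply: derivableM; [exact: (f1.2 k).1|exact: (psi1.2 k).1].
    by rewrite partialM// => x; have := continuousD (cl k x) (cr k x); exact.
  by move=> x /psiM E; rewrite /GRing.mul/= E mulr0.
- apply: (@integrable_continuous_supported M) => // x Mx.
  by rewrite (supported_partial j psiM) ?mulr0.
- apply: (@integrable_continuous_supported M) => // x Mx.
  by rewrite psiM ?mulr0.
Qed.

End integration_by_parts.

(** * Sums over a countable index set *)

Section countable_index.
Context (R : realType) (I : countType).

(** Transfers to sums over a countable type the results on series indexed by
    nat; the indices outside the range of [pickle] contribute 0. *)
Lemma esum_pickle (a : I -> \bar R) : (forall i, 0 <= a i)%E ->
  (\esum_(i in [set: I]) a i =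
   \sum_(0 <= k <oo) (if pickle_inv k is Some i then a i else 0))%E.
Proof.
move=> a0; rewrite nneseries_esumT => [|k]; last by case: pickle_inv.
pose b k := (if @pickle_inv I k is Some i then a i else 0)%E.
rewrite [RHS](_ : _ = \esum_(k in range (@pickle I)) b k)%E.
  rewrite (@reindex_esum R _ _ setT (range (@pickle I)) (@pickle I) b); last first.
    by apply: inj_bij => i j _ _; exact: (pcan_inj pickleK_inv).
  by apply: eq_esum => i _; rewrite /b pickleK_inv.
rewrite [RHS]esum_mkcond; apply: eq_esum => k _; rewrite -/(b k).
case: ifPn => //; rewrite notin_setE/= => kN; rewrite /b.
have := pickle_invK (T := I) k; case: pickle_inv => //= i ik.
by exfalso; apply: kN; exists i.
Qed.

Context (d : measure_display) (T : measurableType d) (mu : {measure set T -> \bar R}).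

Lemma measurable_fun_esum (D : set T) (f : I -> T -> \bar R) :
  (forall i, measurable_fun D (f i)) -> (forall i x, 0 <= f i x)%E ->
  measurable_fun D (fun x => \esum_(i in [set: I]) f i x)%E.
Proof.
move=> mf f0.
under eq_fun do rewrite esum_pickle//.
apply: ge0_emeasurable_sum => [k x _ _|k _]; first by case: pickle_inv.
by case: pickle_inv => // *; exact: measurable_cst.
Qed.

Lemma ge0_integral_esum (D : set T) (f : I -> T -> \bar R) : measurable D ->
  (forall i, measurable_fun D (f i)) -> (forall i x, 0 <= f i x)%E ->
  (\int[mu]_(x in D) (\esum_(i in [set: I]) f i x) =
   \esum_(i in [set: I]) \int[mu]_(x in D) f i x)%E.
Proof.
move=> mD mf f0.
rewrite esum_pickle => [|i]; last exact: integral_ge0.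
under eq_integral do rewrite esum_pickle//.
rewrite (integral_nneseries mu mD) => [|k|k x _]; last 2 first.
- by case: pickle_inv.
- by case: pickle_inv.
apply: eq_eseriesr => k _; case: pickle_inv => //.
exact: integral0.
Qed.

Lemma ae_forall_countable (Q : I -> T -> Prop) :
  (forall i, \forall x \ae mu, Q i x) -> \forall x \ae mu, forall i, Q i x.
Proof.
move=> aeQ.
have : \forall x \ae mu, forall k, (if pickle_inv k is Some i then Q i x else True).
  by apply: ae_foralln => k; case: pickle_inv => //; exact: aeW.
by apply: filterS => x Qx i; have := Qx (pickle i); rewrite pickleK_inv.
Qed.

End countable_index.

(** * Geometry of the lattice *)

Section lattice.
Context (R : realType) (d : nat) (B : 'M[R]_d).
Local Notation Rd := 'rV[R]_d.
Local Notation mu := (lebesgue_rV R d).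
Local Notation r := (lattice_vec B).

Lemma lattice_vecB (z z' : 'rV[int]_d) : r (z - z') = r z - r z'.
Proof. by rewrite /lattice_vec map_mxB mulmxBl. Qed.

Lemma translateE (V : set Rd) (v : Rd) : translate V v = (fun x => x - v) @^-1` V.
Proof.
apply/seteqP; split => [_ [x Vx <-]|x Vx] /=; first by rewrite addrK.
by exists (x - v) => //; rewrite subrK.
Qed.

Lemma measurable_translate_set (V : set Rd) v :
  measurable V -> measurable (translate V v).
Proof.
move=> mV; rewrite translateE -[X in measurable X]setTI.
exact: measurable_translate.
Qed.

(** A crude operator norm, enough to compare a vector with its coordinates in
    the basis of the lattice, in both directions. *)
Lemma norm_mulmx_le (v : Rd) (A : 'M[R]_d) :
  `|v *m A| <= `|v| * \sum_i \sum_j `|A i j|.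
Proof.
apply: norm_rV_le => [|j].
  by rewrite mulr_ge0//; do 2!apply: sumr_ge0 => ? _.
rewrite mxE (le_trans (ler_norm_sum _ _ _))// mulr_sumr ler_sum// => i _.
rewrite normrM ler_pM ?coor_le_norm//.
by rewrite (bigD1 j)//= -[leLHS]addr0 lerD// sumr_ge0.
Qed.

Hypothesis hB : B \in unitmx.

(** Rounding the coordinates of x in the basis B leaves coordinates in [0, 1[. *)
Lemma lattice_cover : exists M, forall x : Rd, exists z, `|x + r z| <= M.
Proof.
exists (\sum_i \sum_j `|B i j|) => x.
pose y := x *m invmx B.
exists (\row_i - Num.floor (y ord0 i)).
have -> : x + r (\row_i - Num.floor (y ord0 i)) =
    (\row_i (y ord0 i - (Num.floor (y ord0 i))%:~R)) *m B.
  rewrite -[in LHS](mulmxKV hB x) -/y /lattice_vec -mulmxDl; congr (_ *m _).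
  by apply/rowP => i; rewrite !mxE rmorphN.
apply: le_trans (norm_mulmx_le _ _) _.
apply: ler_piMl; first by do 2!apply: sumr_ge0 => ? _.
apply: norm_rV_le => // i; rewrite mxE ger0_norm ?subr_ge0 ?floor_le// lerBlDr.
by rewrite addrC -intrD1 ltW// floorD1_gt.
Qed.

(** The coordinates of such lattice points are integers bounded by the operator
    norm of B^-1 times M. *)
Lemma finite_lattice_ball (M : R) : finite_set [set z : 'rV[int]_d | `|r z| <= M].
Proof.
pose K := \sum_i \sum_j `|invmx B i j|.
have K0 : 0 <= K by do 2!apply: sumr_ge0 => ? _.
have [N MN] : exists N : nat, `|M| * K < N%:R.
  by exists (Num.bound (`|M| * K)); rewrite archi_boundP// mulr_ge0.
(* the integer vectors with coordinates between - N and N *)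
pose f (k : 'rV['I_(2 * N).+1]_d) : 'rV[int]_d := \row_i ((k ord0 i)%:Z - N%:Z).
apply: (@sub_finite_set _ _ (range f)); last first.
  by apply: finite_image; exact: finite_finset.
move=> z /= zM.
have zN i : `|z ord0 i| <= N%:Z.
  rewrite -(ler_int R) intr_norm.
  have -> : (z ord0 i)%:~R = (r z *m invmx B) ord0 i by rewrite mulmxK// mxE.
  apply: le_trans (coor_le_norm _ _) _; apply: le_trans (norm_mulmx_le _ _) _.
  apply: le_trans (ltW MN); apply: ler_wpM2r => //.
  exact: le_trans zM (ler_norm _).
exists (\row_i inord `|(z ord0 i + N%:Z)%R|%N) => //.
apply/rowP => i; rewrite !mxE.
have /andP[z1 z2] : - N%:Z <= z ord0 i <= N%:Z by rewrite -ler_norml.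
have zN0 : 0 <= z ord0 i + N%:Z by rewrite -lerBlDr sub0r.
rewrite inordK; first by rewrite gez0_abs// addrK.
by rewrite ltnS -lez_nat gez0_abs// mul2n -addnn PoszD lerD2r.
Qed.

Lemma finite_lattice_translates (M : R) (x : Rd) :
  finite_set [set z : 'rV[int]_d | `|x + r z| <= M].
Proof.
apply: sub_finite_set (finite_lattice_ball (M + `|x|)) => z /= xzM.
by rewrite -[r z](addKr x) addrC (le_trans (ler_normB _ _))// lerD2r.
Qed.

End lattice.

(** * Unfolding integrals over the unit cell *)

Section unfolding.
Context (R : realType) (d : nat) (B : 'M[R]_d) (V : set 'rV[R]_d).
Local Notation Rd := 'rV[R]_d.
Local Notation mu := (lebesgue_rV R d).
Local Notation r := (lattice_vec B).
Hypothesis hV : unit_cell B V.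

Lemma ae_exists_cell : \forall x \ae mu, exists z, V (x - r z).
Proof.
have [mV coverV _] := hV.
exists (~` \bigcup_z translate V (r z)); split => //.
  apply: measurableC; apply: countable_bigcupT_measurable => [|z].
    exact: countableP.
  exact: measurable_translate_set.
move=> x /= nx [z _]; rewrite translateE => xz; apply: nx.
by exists z.
Qed.

(** Up to a translation, two overlapping translates of V are V and another
    translate. *)
Lemma ae_unique_cell : \forall x \ae mu, forall z z',
  V (x - r z) -> V (x - r z') -> z = z'.
Proof.
have [mV _ disjV] := hV.
apply: ae_forall_countable => z; apply: ae_forall_countable => z'.
have [->|zz'] := eqVneq z z'; first exact: aeW.
have z'z : z' - z != 0 by rewrite subr_eq0 eq_sym.
exists ((fun x => x - r z) @^-1` (V `&` translate V (r (z' - z)))); split.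
- rewrite -[X in measurable X]setTI; apply: measurable_translate => //.
  by apply: measurableI => //; exact: measurable_translate_set.
- rewrite -[RHS](disjV _ z'z); apply: lebesgue_rV_translate.
  by apply: measurableI => //; exact: measurable_translate_set.
- move=> x /= nx; apply: contrapT => xN; apply: nx => Vz Vz'.
  exfalso; apply: xN; split => //; rewrite translateE/= lattice_vecB.
  by rewrite opprB addrA subrK.
Qed.

(** Almost every x lies in exactly one translate of V, so g is the sum of its
    restrictions to the translates; each of them is then brought back to V. *)
Lemma unfold_ge0 (g : Rd -> \bar R) : measurable_fun setT g ->
  (forall x, 0 <= g x)%E ->
  (\int[mu]_x g x = \int[mu]_(x in V) \esum_(z in [set: 'rV[int]_d]) g (x + r z)%R)%E.
Proof.
have [mV _ _] := hV => mg g0.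
pose h z := g \_ (translate V (r z)).
have mh z : measurable_fun setT (h z).
  apply/(measurable_restrictT _ _).1; first exact: measurable_translate_set.
  exact: measurable_funTS.
have h0 z x : (0 <= h z x)%E by rewrite /h patchE; case: ifP.
transitivity (\int[mu]_x \esum_(z in [set: 'rV[int]_d]) h z x)%E.
  apply: ge0_ae_eq_integral => //.
  - exact: measurable_fun_esum.
  - by move=> x _; apply: esum_ge0.
  - apply: filterS2 ae_exists_cell ae_unique_cell => x [z Vz] uniq_z _.
    have -> : g x = h z x by rewrite /h patchE translateE mem_set.
    rewrite -[LHS](@esum_set1 _ _ z (h ^~ x))// esum_mkcond.
    apply: eq_esum => z' _; rewrite in_set1; case: eqVneq => // z'z.
    rewrite /h patchE translateE memNset//= => Vz'.
    by move/eqP: z'z; apply; exact: uniq_z.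
rewrite ge0_integral_esum//.
transitivity (\esum_(z in [set: 'rV[int]_d]) \int[mu]_(x in V) g (x + r z)%R)%E.
  apply: eq_esum => z _.
  rewrite -(ge0_integral_translate_rV (r z) (mh z))// [RHS]integral_mkcond.
  apply: eq_integral => x _; rewrite /h !patchE translateE.
  suff -> : (x + r z \in (fun y => y - r z) @^-1` V) = (x \in V) by [].
  by apply/idP/idP; rewrite !inE/= addrK.
rewrite ge0_integral_esum// => z.
apply: measurable_funTS; apply: (measurableT_comp mg).
exact: measurable_translate.
Qed.

End unfolding.

(** * Periodic functions on the unit cell *)

Section periodic_functions.
Context (R : realType) (d : nat) (B : 'M[R]_d) (V : set 'rV[R]_d).
Local Notation Rd := 'rV[R]_d.
Local Notation mu := (lebesgue_rV R d).
Local Notation r := (lattice_vec B).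
Hypotheses (hB : B \in unitmx) (hV : unit_cell B V).
Let mV : measurable V := let: And3 mV _ _ := hV in mV.

Lemma ae_periodic (f : Rd -> R) : Defs.periodic B f ->
  \forall x \ae mu, forall z, f (x + r z) = f x.
Proof.
move=> pf; apply: ae_forall_countable => z.
by apply: filterS (pf z) => x; exact.
Qed.

(** Since V may be unbounded, local integrability says nothing about V directly.
    A cube that meets every orbit of the lattice is used instead: unfolding the
    integral of f over this cube counts each point of V at least once. *)
Lemma cell_integral_le : exists M, forall f : Rd -> R,
  measurable_fun setT f -> Defs.periodic B f -> (forall x, 0 <= f x) ->
  (\int[mu]_(x in V) (f x)%:E <= \int[mu]_(x in cube M) (f x)%:E)%E.
Proof.
have [M coverM] := lattice_cover hB.
exists M => f mf pf f0.
have mE : measurable_fun setT (EFin \o f) by exact/measurable_EFinP.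
pose g := (EFin \o f) \_ (cube M).
have g0 x : (0 <= g x)%E by rewrite /g patchE; case: ifP => //=; rewrite lee_fin.
have mg : measurable_fun setT g.
  apply/(measurable_restrictT _ _).1; first exact: measurable_cube.
  exact: measurable_funTS.
have mgz z : measurable_fun V (fun x => g (x + r z)).
  by apply: measurable_funTS; apply: (measurableT_comp mg); exact: measurable_translate.
rewrite [leRHS]integral_mkcond (unfold_ge0 hV mg g0).
apply: ae_ge0_le_integral => //.
- by move=> x _; rewrite lee_fin.
- exact: measurable_funTS.
- by move=> x _; exact: esum_ge0.
- exact: measurable_fun_esum.
apply: filterS (ae_periodic pf) => x fx _.
have [z zM] := coverM x.
have -> : (f x)%:E = g (x + r z) by rewrite /g patchE mem_set//= fx.
rewrite -[leLHS](@esum_set1 _ _ z (fun z => g (x + r z)))// [leLHS]esum_mkcond.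
by apply: le_esum => z' _; case: ifP.
Qed.

Lemma cell_lty : (mu V < +oo)%E.
Proof.
have [M VM] := cell_integral_le.
have := VM (fun=> 1) (measurable_cst _) _ (fun=> ler01).
rewrite !integral_cst ?mul1e//; last exact: measurable_cube.
move=> H; apply: (le_lt_trans (H _) (lebesgue_cube_lty d M)).
by move=> z; exact: aeW.
Qed.

(** If V were negligible, unfolding the constant 1 would make the whole space
    negligible. *)
Lemma cell_gt0 : (0 < mu V)%E.
Proof.
rewrite lt0e measure_ge0 andbT; apply/eqP => V0.
have := unfold_ge0 hV (@measurable_cst _ _ _ _ setT (1 : \bar R)%E) (fun=> lee01).
rewrite [X in _ = X -> _]null_set_integral//; last exact: measurable_fun_esum.
by rewrite integral_cst// mul1e => T0; have := lebesgue_setT_gt0 R d; rewrite T0 ltxx.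
Qed.

Lemma L2per_sqr_integrable (f : Rd -> R) : L2per B f ->
  mu.-integrable V (EFin \o (fun x => f x ^+ 2)).
Proof.
move=> [[mf f2] pf]; have [M VM] := cell_integral_le.
have mf2 : measurable_fun setT (fun x => f x ^+ 2).
  exact: measurable_funX.
apply/integrableP; split; first exact/measurable_EFinP/measurable_funTS.
under eq_integral do rewrite /= ger0_norm ?sqr_ge0//.
apply: le_lt_trans (VM _ mf2 _ _) (f2 _ (@compact_cube _ _ _)) => [z|x].
  by apply: filterS (pf z) => x /= ->.
exact: sqr_ge0.
Qed.

Lemma L2perM_integrable (f g : Rd -> R) : L2per B f -> L2per B g ->
  mu.-integrable V (EFin \o (fun x => f x * g x)).
Proof.
move=> f2 g2.
have fg := integrableD mV (L2per_sqr_integrable f2) (L2per_sqr_integrable g2).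
have [[[mf _] _] [[mg _] _]] := (f2, g2).
apply: le_integrable fg => //.
  by apply/measurable_EFinP/measurable_funTS; exact: measurable_funM.
move=> x _ /=; rewrite lee_fin [leRHS]ger0_norm ?addr_ge0 ?sqr_ge0//.
rewrite normrM -[f x ^+ 2]real_normK ?num_real// -[g x ^+ 2]real_normK ?num_real//.
have := normr_ge0 (f x); have := normr_ge0 (g x).
by move: `|f x| `|g x| => a b b0 a0; nra.
Qed.

Lemma compact_measurable_rV (K : set Rd) : compact K -> measurable K.
Proof.
move=> cK; rewrite -[K]setCK; apply: measurableC; apply: open_measurable_rV.
by apply: closed_openC; apply: compact_closed => //; exact: norm_hausdorff.
Qed.

Lemma continuous_L2loc (f : Rd -> R) : continuous f -> L2loc f.
Proof.
move=> cf; split; first exact: continuous_measurable_rV.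
move=> K cK.
have mK := compact_measurable_rV cK.
have [M KM] : exists M, K `<=` cube M.
  have [M [_ KM]] := compact_bounded cK.
  by exists (M + 1) => x Kx; apply: (KM (M + 1)) => //; rewrite ltrDl.
have [C fC] := continuous_bounded_on_cube M cf.
have mf2 : measurable_fun setT (fun x => f x ^+ 2).
  by apply: measurable_funX; exact: continuous_measurable_rV.
apply: (@le_lt_trans _ _ (\int[mu]_(x in K) (C ^+ 2)%:E)%E).
  apply: ge0_le_integral => //.
  - by move=> x _; rewrite lee_fin sqr_ge0.
  - by apply/measurable_EFinP; exact: measurable_funTS mf2.
  - move=> x /KM /fC fxC; rewrite lee_fin -[leLHS]real_normK ?num_real//.
    by rewrite lerXn2r// nnegrE// (le_trans _ fxC).
rewrite integral_cst//; apply: lte_mul_pinfty; rewrite ?lee_fin ?sqr_ge0//.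
apply: le_lt_trans (lebesgue_cube_lty d M); apply: le_measure => //; rewrite inE//.
exact: measurable_cube.
Qed.

Lemma L2per_cst (c : R) : L2per B (cst c).
Proof. by split; [apply: continuous_L2loc; exact: cst_continuous|move=> z; exact: aeW]. Qed.

Lemma L2per_integrable (f : Rd -> R) : L2per B f -> mu.-integrable V (EFin \o f).
Proof.
move=> f2; have := L2perM_integrable f2 (L2per_cst 1).
by under eq_fun do rewrite mulr1.
Qed.

Lemma periodic_ae0 (f : Rd -> R) : measurable_fun setT f -> Defs.periodic B f ->
  (\forall x \ae mu, V x -> f x = 0) -> \forall x \ae mu, f x = 0.
Proof.
move=> mf pf fV0.
pose h x := (`|f x|)%:E.
have h0 x : (0 <= h x)%E by rewrite lee_fin.
have mh : measurable_fun setT h by apply/measurable_EFinP; exact: measurableT_comp.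
suff : ae_eq mu setT h (cst 0%E).
  apply: filterS => x /(_ I)/= /eqP; rewrite eqe normr_eq0 => /eqP fx.
  exact: fx.
apply/ae_eq_integral_abs => //.
under eq_integral do rewrite gee0_abs//.
rewrite (unfold_ge0 hV mh)//.
have mhz z : measurable_fun V (fun x => h (x + r z)).
  apply: measurable_funTS; apply: (measurableT_comp mh).
  exact: measurable_translate.
rewrite (ae_eq_integral (cst 0%E))// ?integral0//.
  exact: measurable_fun_esum.
apply: filterS2 fV0 (ae_periodic pf) => x fV0 fx /fV0 E.
by apply: esum1 => z _; rewrite /h fx E normr0.
Qed.

End periodic_functions.

(** * Periodization of compactly supported functions *)

Section periodization.
Context (R : realType) (d : nat) (B : 'M[R]_d) (V : set 'rV[R]_d).
Local Notation Rd := 'rV[R]_d.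
Local Notation mu := (lebesgue_rV R d).
Local Notation r := (lattice_vec B).
Hypotheses (hB : B \in unitmx) (hV : unit_cell B V).
Let mV : measurable V := let: And3 mV _ _ := hV in mV.
Implicit Types f g : Rd -> R.

Definition periodize g x := \sum_(z \in [set: 'rV[int]_d]) g (x + r z).

(** Any set of lattice vectors that contains those of the support gives the same
    sum; the two variants used below are the points of a cube and, uniformly
    for x in a cube, the lattice vectors of bounded norm. *)
Lemma periodize_finite (M : R) g x (F : set 'rV[int]_d) : supported_in_cube M g ->
  [set z | `|x + r z| <= M] `<=` F ->
  periodize g x = \sum_(z \in F) g (x + r z).
Proof.
move=> gM MF; apply/esym; apply: fsbig_widen => // z [_ Fz] /=.
by apply: gM; rewrite ltNge; apply/negP => /MF.
Qed.

Lemma periodize_near (M K : R) g x : supported_in_cube M g -> `|x| <= K ->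
  periodize g x =
    \sum_(z <- finmap.enum_fset (fset_set [set z | `|r z| <= M + K])) g (x + r z).
Proof.
move=> gM xK; rewrite -fsbig_finite; last exact: finite_lattice_ball.
apply: periodize_finite gM _ => z /= xzM.
rewrite -[r z](addKr x) addrC (le_trans (ler_normB _ _))// lerD//.
Qed.

Lemma periodize_periodic g (z : 'rV[int]_d) x : periodize g (x + r z) = periodize g x.
Proof.
rewrite /periodize [RHS](@reindex_fsbigT _ _ _ _ _ (fun z' => z + z')).
  apply: eq_fsbigr => z' _; congr g; rewrite -addrA; congr (_ + _).
  by rewrite /lattice_vec map_mxD mulmxDl.
exists (fun z' => z' - z) => z'; [rewrite addrAC subrr add0r//|].
by rewrite addrC subrK.
Qed.

Lemma periodizeB (M : R) f g x : supported_in_cube M f -> supported_in_cube M g ->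
  periodize (fun x => f x - g x) x = periodize f x - periodize g x.
Proof.
move=> fM gM.
have fgM : supported_in_cube M (fun x => f x - g x).
  by move=> y yM; rewrite fM// gM// subrr.
by rewrite !(@periodize_near M `|x|)// sumrB.
Qed.

(** The form of the periodization to which unfolding applies. *)
Lemma ge0_periodize_esum (M : R) g x : supported_in_cube M g -> (forall x, 0 <= g x) ->
  (periodize g x)%:E = (\esum_(z in [set: 'rV[int]_d]) (g (x + r z))%:E)%E.
Proof.
move=> gM g0; pose F := [set z | `|x + r z| <= M].
have finF : finite_set F by exact: finite_lattice_translates.
rewrite (periodize_finite (F := F) gM)// -fsumEFin// -esum_fset//; last first.
  by move=> z _; rewrite lee_fin.
rewrite esum_mkcond; apply: eq_esum => z _; case: ifPn => //.
by rewrite notin_setE /F/= => /negP; rewrite -ltNge => /gM ->.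
Qed.

Lemma ge0_integral_periodize (M : R) g : supported_in_cube M g -> (forall x, 0 <= g x) ->
  mu.-integrable setT (EFin \o g) ->
  mu.-integrable V (EFin \o periodize g) /\
  \int[mu]_x g x = \int[mu]_(x in V) periodize g x.
Proof.
move=> gM g0 ig; have /integrableP[mg goo] := ig.
have mz z : measurable_fun V (fun x => (g (x + r z))%:E).
  apply: measurable_funTS; exact: (measurableT_comp mg (measurable_translate (r z))).
have E : (\int[mu]_x (g x)%:E = \int[mu]_(x in V) (periodize g x)%:E)%E.
  rewrite (unfold_ge0 hV mg) => [|x]; last by rewrite lee_fin.
  by apply: eq_integral => x _; rewrite (ge0_periodize_esum _ gM).
split; last by rewrite /Rintegral E.
have P0 x : 0 <= periodize g x.
  by rewrite -lee_fin (ge0_periodize_esum _ gM)//; apply: esum_ge0 => z _; rewrite lee_fin.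
apply/integrableP; split.
  rewrite (_ : _ \o _ = (fun x => \esum_(z in [set: 'rV[int]_d]) (g (x + r z))%:E)%E).
    by apply: measurable_fun_esum => // z x; rewrite lee_fin.
  by apply/funext => x /=; rewrite (ge0_periodize_esum _ gM).
under eq_integral do rewrite /= ger0_norm//.
rewrite -E; move: goo; under eq_integral do rewrite /= ger0_norm//.
by [].
Qed.

(** Unfolding is available for nonnegative functions only, hence the
    decomposition into positive and negative parts, which have the same
    support. *)
Lemma integral_periodize (M : R) g : supported_in_cube M g ->
  mu.-integrable setT (EFin \o g) ->
  mu.-integrable V (EFin \o periodize g) /\
  \int[mu]_x g x = \int[mu]_(x in V) periodize g x.
Proof.
move=> gM ig; have /integrableP[/measurable_EFinP mg _] := ig.
pose gp x := Num.max (g x) 0; pose gn x := Num.max (- g x) 0.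
have gE : g = fun x => gp x - gn x.
  apply/funext => x; rewrite /gp /gn; have [g0|g0] := leP 0 (g x).
    by rewrite max_r ?subr0// oppr_le0.
  by rewrite max_l ?sub0r ?opprK// oppr_ge0 ltW.
have igp : mu.-integrable setT (EFin \o gp).
  apply: (le_integrable _ _ _ ig) => //.
    by apply/measurable_EFinP; exact: measurable_maxr.
  by move=> x _ /=; rewrite lee_fin /gp; have [g0|g0] := leP (g x) 0; rewrite ?normr0.
have ign : mu.-integrable setT (EFin \o gn).
  apply: (le_integrable _ _ _ ig) => //.
    by apply/measurable_EFinP; apply: measurable_maxr => //; exact: measurableT_comp.
  move=> x _ /=; rewrite lee_fin /gn.
  by have [g0|g0] := leP (- g x) 0; rewrite ?normr0 ?normrN.
have gpM : supported_in_cube M gp by move=> x /gM; rewrite /gp => ->; rewrite maxxx.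
have gnM : supported_in_cube M gn by move=> x /gM; rewrite /gn => ->; rewrite oppr0 maxxx.
have gp0 x : 0 <= gp x by rewrite le_max lexx orbT.
have gn0 x : 0 <= gn x by rewrite le_max lexx orbT.
have [iP EP] := ge0_integral_periodize gpM gp0 igp.
have [iN EN] := ge0_integral_periodize gnM gn0 ign.
have PE : periodize g = (fun x => periodize gp x - periodize gn x).
  by apply/funext => x; rewrite -(periodizeB _ gpM gnM) -gE.
split; first by rewrite PE; exact: (integrableB mV iP iN).
by rewrite PE RintegralB// -EP -EN -RintegralB// [in LHS]gE.
Qed.

End periodization.

Section smooth_periodization.
Context (R : realType) (d : nat) (B : 'M[R]_d) (V : set 'rV[R]_d).
Local Notation Rd := 'rV[R]_d.
Local Notation mu := (lebesgue_rV R d).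
Local Notation r := (lattice_vec B).
Hypotheses (hB : B \in unitmx) (hV : unit_cell B V).
Let mV : measurable V := let: And3 mV _ _ := hV in mV.
Implicit Types f g : Rd -> R.

Lemma near_norm_lt (x : Rd) (K : R) : `|x| < K -> \forall y \near x, `|y| < K.
Proof.
exact: (@cvgr_lt _ _ _ _ (fun y : Rd => `|y|) `|x| (@norm_continuous _ _ x) K).
Qed.

(** Periodization is locally a finite sum, with an index set that does not depend
    on the point: continuity and derivatives can be computed termwise. *)
Lemma near_periodize (M : R) g (x : Rd) : supported_in_cube M g ->
  exists F : seq 'rV[int]_d, \forall y \near x,
    periodize B g y = \sum_(z <- F) g (y + r z).
Proof.
move=> gM; exists (finmap.enum_fset (fset_set [set z | `|r z| <= M + (`|x| + 1)])).
have : \forall y \near x, `|y| < `|x| + 1.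
  by apply: near_norm_lt; rewrite ltrDl.
by apply: filterS => y /ltW; exact: periodize_near.
Qed.

Lemma continuous_shift g (w : Rd) :
  continuous g -> continuous (fun x : Rd => g (x + w)).
Proof.
move=> cg x; apply: (@continuous_comp _ _ _ (fun y : Rd => y + w) g); last exact: cg.
exact: (@continuousD R Rd Rd id (cst w) x (@cvg_id _ _) (@cst_continuous _ _ _ _)).
Qed.

Lemma continuous_periodize (M : R) g : continuous g -> supported_in_cube M g ->
  continuous (periodize B g).
Proof.
move=> cg gM x; have [F PF] := near_periodize x gM.
have cF : {for x, continuous (fun y : Rd => \sum_(z <- F) g (y + r z))}.
  elim: F {PF} => [|z F IHF].
    have -> : (fun y : Rd => \sum_(z <- [::]) g (y + r z)) = cst 0.
      by apply/funext => y; rewrite big_nil.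
    exact: cst_continuous.
  have -> : (fun y : Rd => \sum_(z' <- z :: F) g (y + r z')) =
      (fun y : Rd => g (y + r z)) + (fun y : Rd => \sum_(z' <- F) g (y + r z')).
    by apply/funext => y; rewrite big_cons.
  have := continuousD (@continuous_shift g (r z) cg x) IHF; exact.
rewrite /continuous_at (nbhs_singleton PF).
apply: cvg_trans cF; apply: (near_eq_cvg (F := nbhs (x : Rd))).
by apply: filterS PF => y ->.
Qed.

Lemma is_derive_shift g (w x v : Rd) : derivable g (x + w) v ->
  is_derive x v (fun y => g (y + w)) ('D_v g (x + w)).
Proof.
move=> dg.
have E : (fun h : R => h^-1 *: (((fun y => g (y + w)) \o shift x) (h *: v) - g (x + w))) =
         (fun h : R => h^-1 *: ((g \o shift (x + w)) (h *: v) - g (x + w))).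
  by apply/funext => h /=; rewrite addrA.
by apply: DeriveDef; rewrite /derivable /derive E.
Qed.

Lemma is_derive_periodize (M : R) j g (x : Rd) : Ck 1 g -> supported_in_cube M g ->
  is_derive x (delta_mx 0 j) (periodize B g) (periodize B (partial j g) x).
Proof.
move=> g1 gM.
have [F PF] := near_periodize x gM.
have [F' PF'] := near_periodize x (supported_partial j gM).
pose K := `|x| + 1.
have xK : `|x| <= K by rewrite lerDl.
rewrite (periodize_near hB (supported_partial j gM) xK).
have near_K : \forall y \near x,
    \sum_(z <- finmap.enum_fset (fset_set [set z | `|r z| <= M + K])) g (y + r z) =
    periodize B g y.
  have : \forall y \near x, `|y| < K.
    by apply: near_norm_lt; rewrite ltrDl.
  by apply: filterS => y /ltW yK; rewrite (periodize_near hB gM yK).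
apply: near_eq_is_derive near_K _.
elim: (finmap.enum_fset _) => [|z s IHs].
  have -> : (fun y : Rd => \sum_(z <- [::]) g (y + r z)) = cst 0.
    by apply/funext => y; rewrite big_nil.
  by rewrite big_nil; exact: is_derive_cst.
have -> : (fun y : Rd => \sum_(z' <- z :: s) g (y + r z')) =
    (fun y : Rd => g (y + r z)) + (fun y : Rd => \sum_(z' <- s) g (y + r z')).
  by apply/funext => y; rewrite big_cons.
rewrite big_cons; apply: is_deriveD.
by apply: is_derive_shift; exact: (g1.2 j).1.
Qed.

Lemma partial_periodize (M : R) j g : Ck 1 g -> supported_in_cube M g ->
  partial j (periodize B g) = periodize B (partial j g).
Proof.
move=> g1 gM; apply/funext => x.
by have [_ E] := is_derive_periodize j x g1 gM; exact: E.
Qed.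

Lemma Ck1_periodize (M : R) g : Ck 1 g -> supported_in_cube M g ->
  Ck 1 (periodize B g).
Proof.
move=> g1 gM; split; first exact: continuous_periodize g1.1 gM.
move=> j; split=> [x|]; first by have [] := is_derive_periodize j x g1 gM.
rewrite (partial_periodize _ g1 gM).
exact: continuous_periodize (g1.2 j).2 (supported_partial j gM).
Qed.

Lemma test_function_Ck1 (phi : Rd -> R) : test_function phi -> Ck 1 phi.
Proof. by move=> [/(_ 1%N)]. Qed.

Lemma test_function_supported (phi : Rd -> R) : test_function phi ->
  exists M, supported_in_cube M phi.
Proof.
move=> [_ /compact_bounded[M [_ KM]]]; exists (M + 1) => x Mx.
apply/eqP; apply: contraTT Mx => phix; rewrite -leNgt.
by apply: (KM (M + 1)); [rewrite ltrDl|exact: subset_closure].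
Qed.

Lemma weak_partial_Ck1 j f : Ck 1 f -> weak_partial j f (partial j f).
Proof.
move=> f1 phi tphi; have [M phiM] := test_function_supported tphi.
exact: integration_by_parts_rV f1 (test_function_Ck1 tphi) phiM.
Qed.

(** |f g| <= f^2 + g^2 on the cube, where f is square integrable. *)
Lemma L2locM_integrable (M : R) f g : L2loc f -> continuous g ->
  supported_in_cube M g -> mu.-integrable setT (EFin \o (fun x => f x * g x)).
Proof.
move=> [mf f2] cg gM.
have mcube := @measurable_cube R d M.
have if2 : mu.-integrable setT ((EFin \o (fun x => f x ^+ 2)) \_ (cube M)).
  apply/(integrable_mkcond _ _).1 => //.
  apply/integrableP; split.
    by apply/measurable_EFinP; apply: measurable_funTS; exact: measurable_funX.
  under eq_integral do rewrite /= ger0_norm ?sqr_ge0//.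
  exact: f2 (@compact_cube _ _ _).
have ig2 : mu.-integrable setT (EFin \o (fun x => g x * g x)).
  apply: (@integrable_continuous_supported _ _ M); first exact: continuousM_rV.
  by move=> x /gM ->; rewrite mulr0.
apply: (le_integrable _ _ _ (integrableD _ if2 ig2)) => //.
  by apply/measurable_EFinP; apply: measurable_funM => //; exact: continuous_measurable_rV.
move=> x _; rewrite /= patchE; have [xM|xM] := leP `|x| M.
  rewrite mem_set//= lee_fin [leRHS]ger0_norm; last first.
    by rewrite addr_ge0 ?sqr_ge0// -expr2 sqr_ge0.
  rewrite normrM -[f x ^+ 2]real_normK ?num_real// -expr2 -[g x ^+ 2]real_normK ?num_real//.
  have := normr_ge0 (f x); have := normr_ge0 (g x).
  by move: `|f x| `|g x| => a b b0 a0; nra.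
by rewrite gM// mulr0 normr0 abse_ge0.
Qed.

(** Periodizing f g amounts to periodizing g, because f is periodic. *)
Lemma integral_periodic_mul (M : R) f g : L2per B f -> continuous g ->
  supported_in_cube M g ->
  \int[mu]_x (f x * g x) = \int[mu]_(x in V) (f x * periodize B g x).
Proof.
move=> [f2 pf] cg gM.
have [iP ->] := integral_periodize hB hV (M := M) 
  (fun x xM => etrans (congr1 _ (gM x xM)) (mulr0 _))
  (L2locM_integrable f2 cg gM).
have /integrableP[mP _] := iP; congr fine; apply: ae_eq_integral => //.
- apply/measurable_EFinP/measurable_funTS; apply: measurable_funM; first exact: f2.1.
  by apply: continuous_measurable_rV; exact: continuous_periodize gM.
apply: filterS (ae_periodic pf) => x fx _; congr EFin.
rewrite /periodize mulr_fsumr; apply: eq_fsbigr => z _.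
by rewrite fx.
Qed.

End smooth_periodization.

(** * Fourth-order tensors on symmetric matrices *)

Section tensors.
Context (R : realType) (d : nat).
Implicit Types (L T : tensor4 R d) (a b e s : 'M[R]_d).

Lemma tensor_app_is_linear L (c : R) a b :
  tensor_app L (c *: a + b) = c *: tensor_app L a + tensor_app L b.
Proof.
apply/matrixP => i j; rewrite !mxE mulr_sumr -big_split; apply: eq_bigr => k _ /=.
rewrite mulr_sumr -big_split; apply: eq_bigr => l _ /=.
by rewrite !mxE; ring.
Qed.

Lemma tensor_appB L a b : tensor_app L (a - b) = tensor_app L a - tensor_app L b.
Proof. by rewrite addrC -scaleN1r tensor_app_is_linear scaleN1r [RHS]addrC. Qed.

Lemma tensor_app0 L : tensor_app L 0 = 0.
Proof. by have := tensor_appB L 0 0; rewrite !subrr. Qed.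

Lemma ddotC s e : ddot s e = ddot e s.
Proof. by apply: eq_bigr => i _; apply: eq_bigr => j _; rewrite mulrC. Qed.

Lemma ddotBl a b e : ddot (a - b) e = ddot a e - ddot b e.
Proof.
rewrite /ddot -sumrB; apply: eq_bigr => i _; rewrite -sumrB.
by apply: eq_bigr => j _; rewrite !mxE mulrBl.
Qed.

Lemma ddot_tensor_app L a b : major_symmetry L ->
  ddot (tensor_app L a) b = ddot a (tensor_app L b).
Proof.
move=> majL; rewrite /ddot.
transitivity (\sum_i \sum_j \sum_k \sum_l L i j k l * a k l * b i j).
  apply: eq_bigr => i _; apply: eq_bigr => j _; rewrite mxE mulr_suml.
  by apply: eq_bigr => k _; rewrite mulr_suml.
rewrite pair_big/=.
rewrite (eq_bigr (fun p => \sum_q L p.1 p.2 q.1 q.2 * a q.1 q.2 * b p.1 p.2)); last first.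
  by move=> p _; rewrite pair_big.
rewrite exchange_big/= [RHS]pair_big/=; apply: eq_bigr => q _.
rewrite mxE pair_big/= mulr_sumr; apply: eq_bigr => p _.
by rewrite majL mulrCA mulrA.
Qed.

Lemma tensor_app_symmetric L e : minor_symmetries L -> Defs.symmetric (tensor_app L e).
Proof.
move=> minL; apply/matrixP => i j; rewrite !mxE.
by apply: eq_bigr => k _; apply: eq_bigr => l _; rewrite (minL j i k l).1.
Qed.

Section inverse.
Context L (minL : minor_symmetries L) (posL : positive_definite L).

Lemma tensor_app_inj a : Defs.symmetric a -> tensor_app L a = 0 -> a = 0.
Proof.
move=> sa La; apply/eqP; apply: contraT => /(posL sa).
rewrite La /ddot big1 ?ltxx// => i _; rewrite big1// => j _.
by rewrite mxE mul0r.
Qed.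

(** L on symmetric matrices, extended by the identity on antisymmetric ones. *)
Let F (e : 'M[R]_d) : 'M[R]_d :=
  tensor_app L (2^-1 *: (e + e^T)) + 2^-1 *: (e - e^T).

Let F_linear : linear F.
Proof.
move=> c a b; rewrite /F.
have -> : 2^-1 *: (c *: a + b + (c *: a + b)^T) =
    c *: (2^-1 *: (a + a^T)) + 2^-1 *: (b + b^T).
  by apply/matrixP => i j; rewrite !mxE; lra.
rewrite tensor_app_is_linear.
apply/matrixP => i j; rewrite !mxE; lra.
Qed.

HB.instance Definition _ := GRing.isLinear.Build R 'M[R]_d 'M[R]_d _ F F_linear.

Let F_sym s e : Defs.symmetric s -> F e = s -> Defs.symmetric e /\ tensor_app L e = s.
Proof.
move=> ss Fe; have FeT : (F e)^T = F e by rewrite Fe.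
have se : Defs.symmetric e.
  move: FeT; rewrite /F linearD/= [X in X + _ = _](tensor_app_symmetric _ minL).
  move=> /addrI /matrixP eT; apply/matrixP => i j.
  by have := eT i j; rewrite !mxE; lra.
split=> //; rewrite -Fe /F se subrr scaler0 addr0; congr tensor_app.
by apply/matrixP => i j; rewrite !mxE; lra.
Qed.

(** The inverse on symmetric matrices is again given by a fourth-order tensor.
    This is what keeps the components of [field_inv L s] in L^2. It is
    obtained from the inverse of the injective endomorphism F of the space of
    all matrices. *)
Lemma tensor_invP : exists T, forall s, Defs.symmetric s ->
  tensor_inv L s = tensor_app T s /\
  (Defs.symmetric (tensor_inv L s) /\ tensor_app L (tensor_inv L s) = s).
Proof.
pose f := linfun F.
have kf : lker f == 0%VS.
  apply/lker0P => a b; rewrite !lfunE/= => Fab; apply/eqP; rewrite -subr_eq0; apply/eqP.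
  have : F (a - b) = 0 by rewrite linearB/= Fab subrr.
  have s0 : Defs.symmetric (0 : 'M[R]_d) by exact: trmx0.
  by move=> /(F_sym s0)[sab]; exact: tensor_app_inj.
pose T : tensor4 R d := fun i j k l => (f^-1)%VF (delta_mx k l) i j.
have TE s : tensor_app T s = (f^-1)%VF s.
  rewrite [in RHS](matrix_sum_delta s) linear_sum; apply/matrixP => i j.
  rewrite mxE summxE; apply: eq_bigr => k _; rewrite linear_sum summxE.
  by apply: eq_bigr => l _; rewrite linearZ mxE mulrC.
exists T => s ss.
have : Defs.symmetric (tensor_app T s) /\ tensor_app L (tensor_app T s) = s.
  apply: F_sym => //; rewrite TE.
  have := lker0_lfunVK kf s; rewrite lfunE; exact.
move=> [sT LT]; rewrite /tensor_inv; case: xgetP => [e -> [se Le]|]; last first.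
  by move=> /(_ (tensor_app T s)); case.
split=> //; apply/eqP; rewrite -subr_eq0; apply/eqP; apply: tensor_app_inj.
  by rewrite /Defs.symmetric linearB/= se sT.
by rewrite tensor_appB Le LT subrr.
Qed.

End inverse.

End tensors.

(** * The average pairing of tensor fields *)

Section L2_algebra.
Context (R : realType) (d : nat) (B : 'M[R]_d).
Local Notation Rd := 'rV[R]_d.
Local Notation mu := (lebesgue_rV R d).
Implicit Types f g : Rd -> R.

(** (a f + g)^2 <= 2 a^2 f^2 + 2 g^2. *)
Lemma L2loc_linear (a : R) f g : L2loc f -> L2loc g -> L2loc (fun x => a * f x + g x).
Proof.
move=> [mf f2] [mg g2].
have mfg : measurable_fun setT (fun x => a * f x + g x).
  by apply: measurable_funD => //; exact: measurable_funM.
split=> // K cK; have mK := compact_measurable_rV cK.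
have mX (h : Rd -> R) : measurable_fun setT h -> measurable_fun K (fun x => (h x ^+ 2)%:E).
  by move=> mh; apply/measurable_EFinP; apply: measurable_funTS; exact: measurable_funX.
apply: (@le_lt_trans _ _ (\int[mu]_(x in K)
    ((2 * a ^+ 2)%:E * (f x ^+ 2)%:E + 2%:E * (g x ^+ 2)%:E))%E).
  apply: ge0_le_integral => //.
  - by move=> x _; rewrite lee_fin sqr_ge0.
  - exact: mX.
  - by apply: emeasurable_funD; apply: measurable_funeM; exact: mX.
  - move=> x _; rewrite -!EFinM -EFinD lee_fin -subr_ge0.
    rewrite [leRHS](_ : _ = (a * f x - g x) ^+ 2) ?sqr_ge0//; ring.
have a0 : 0 <= 2 * a ^+ 2 by rewrite mulr_ge0 ?sqr_ge0.
have cX0 (c : R) (h : Rd -> R) x : 0 <= c -> (0 <= c%:E * (h x ^+ 2)%:E)%E.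
  by move=> c0; rewrite -EFinM lee_fin mulr_ge0 ?sqr_ge0.
have mcX (c : R) (h : Rd -> R) : measurable_fun setT h ->
    measurable_fun K (fun x => c%:E * (h x ^+ 2)%:E)%E.
  by move=> mh; apply: measurable_funeM; exact: mX.
have cXoo (c : R) (h : Rd -> R) : 0 <= c -> L2loc h ->
    (\int[mu]_(x in K) (c%:E * (h x ^+ 2)%:E) < +oo)%E.
  move=> c0 [mh h2]; rewrite ge0_integralZl_EFin//.
  - by apply: lte_mul_pinfty; rewrite ?lee_fin//; exact: h2.
  - by move=> x _; rewrite lee_fin sqr_ge0.
  - exact: mX.
rewrite ge0_integralD//.
- by apply: lte_add_pinfty; exact: cXoo.
- by move=> x _; exact: cX0.
- exact: mcX.
- by move=> x _; exact: cX0.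
- exact: mcX.
Qed.

Lemma L2per_linear (a : R) f g :
  L2per B f -> L2per B g -> L2per B (fun x => a * f x + g x).
Proof.
move=> [f2 pf] [g2 pg]; split; first exact: L2loc_linear.
by move=> z; apply: filterS2 (pf z) (pg z) => x /= -> // ->.
Qed.

Lemma L2per_sum (I : finType) (c : I -> R) (f : I -> Rd -> R) :
  (forall i, L2per B (f i)) -> L2per B (fun x => \sum_i c i * f i x).
Proof.
move=> f2; elim: (index_enum I) => [|i s IHs].
  under eq_fun do rewrite big_nil; exact: L2per_cst.
under eq_fun do rewrite big_cons; exact: L2per_linear.
Qed.

End L2_algebra.

Section pairing.
Context (R : realType) (d : nat) (B : 'M[R]_d) (V : set 'rV[R]_d).
Local Notation Rd := 'rV[R]_d.
Local Notation mu := (lebesgue_rV R d).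
Hypotheses (hB : B \in unitmx) (hV : unit_cell B V).
Let mV : measurable V := let: And3 mV _ _ := hV in mV.
Implicit Types (a b e s : field R d).

Lemma cell_fine_neq0 : fine (mu V) != 0.
Proof.
rewrite fine_eq0 ?ge0_fin_numE ?(cell_lty hB hV)//.
by rewrite gt_eqF// (cell_gt0 hV).
Qed.

Lemma average_cst (c : R) : average V (fun=> c) = c.
Proof. by rewrite /average Rintegral_cst// mulrCA mulVf ?mulr1 ?cell_fine_neq0. Qed.

Lemma averageB (f g : Rd -> R) :
  mu.-integrable V (EFin \o f) -> mu.-integrable V (EFin \o g) ->
  average V (fun x => f x - g x) = average V f - average V g.
Proof. by move=> fi gi; rewrite /average RintegralB// mulrBr. Qed.

Definition L2per_field e := forall i j, L2per B (fun x => e x i j).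

Definition pairing s e := average V (fun x => ddot (s x) (e x)).

Lemma L2per_fieldB a b : L2per_field a -> L2per_field b ->
  L2per_field (fun x => a x - b x).
Proof.
move=> a2 b2 i j.
under eq_fun do rewrite !mxE addrC -mulN1r.
exact: L2per_linear.
Qed.

Lemma L2per_field_cst (c : 'M[R]_d) : L2per_field (fun=> c).
Proof. by move=> i j; exact: L2per_cst. Qed.

Lemma Rintegral_sum (I : finType) (f : I -> Rd -> R) :
  (forall i, mu.-integrable V (EFin \o f i)) ->
  mu.-integrable V (EFin \o (fun x => \sum_i f i x)) /\
  \int[mu]_(x in V) (\sum_i f i x) = \sum_i \int[mu]_(x in V) f i x.
Proof.
move=> fi; elim: (index_enum I) => [|i s [IHi IHs]].
  under eq_fun do rewrite big_nil.
  split; first exact: integrable0.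
  by rewrite big_nil /Rintegral (eq_integral (fun=> 0%E)) ?integral0// => x _; rewrite big_nil.
split.
  under eq_fun do rewrite big_cons.
  exact: (integrableD mV (fi i) IHi).
rewrite big_cons -IHs -RintegralD//.
by apply: eq_Rintegral => x _; rewrite big_cons.
Qed.

Lemma ddot_integrable s e : L2per_field s -> L2per_field e ->
  mu.-integrable V (EFin \o (fun x => ddot (s x) (e x))).
Proof.
move=> s2 e2; apply: (Rintegral_sum _).1 => i; apply: (Rintegral_sum _).1 => j.
exact: (L2perM_integrable hB hV (s2 i j) (e2 i j)).
Qed.

Lemma pairingE s e : L2per_field s -> L2per_field e ->
  pairing s e = (fine (mu V))^-1 * \sum_i \sum_j \int[mu]_(x in V) (s x i j * e x i j).
Proof.
move=> s2 e2; rewrite /pairing /average; congr (_ * _).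
have ise i j := L2perM_integrable hB hV (s2 i j) (e2 i j).
rewrite (Rintegral_sum (fun i => (Rintegral_sum (ise i)).1)).2.
by apply: eq_bigr => i _; rewrite (Rintegral_sum (ise i)).2.
Qed.

Lemma pairingC s e : pairing s e = pairing e s.
Proof. by rewrite /pairing; congr average; apply/funext => x; rewrite ddotC. Qed.

Lemma pairingBl a b e : L2per_field a -> L2per_field b -> L2per_field e ->
  pairing (fun x => a x - b x) e = pairing a e - pairing b e.
Proof.
move=> a2 b2 e2; rewrite /pairing -averageB; [|exact: ddot_integrable..].
by congr average; apply/funext => x; rewrite ddotBl.
Qed.

Lemma pairing_ae s a b : L2per_field s -> L2per_field a -> L2per_field b ->
  a = b %[ae mu] -> pairing s a = pairing s b.
Proof.
move=> s2 a2 b2 ab; congr (_ * fine _); apply: ae_eq_integral => //.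
- by have /integrableP[] := ddot_integrable s2 a2.
- by have /integrableP[] := ddot_integrable s2 b2.
by apply: filterS ab => x /= -> //.
Qed.

Lemma pairing_cst s (c : 'M[R]_d) : L2per_field s -> mean V s = (fun=> 0) ->
  pairing s (fun=> c) = 0.
Proof.
move=> s2 s0; rewrite pairingE//; last exact: L2per_field_cst.
rewrite mulr_sumr big1// => i _; rewrite mulr_sumr big1// => j _.
rewrite RintegralZr//; last exact: (L2per_integrable hB hV (s2 i j)).
have /matrixP/(_ i j) := congr1 (fun f => f 0) s0; rewrite !mxE => sij.
by rewrite mulrA -/(average V _) sij mul0r.
Qed.

End pairing.

(** * Fields orthogonal to all compatible strains *)

Section orthogonal_to_strains.
Context (R : realType) (d : nat) (B : 'M[R]_d) (V : set 'rV[R]_d).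
Local Notation Rd := 'rV[R]_d.
Local Notation mu := (lebesgue_rV R d).
Local Notation r := (lattice_vec B).
Hypotheses (hB : B \in unitmx) (hV : unit_cell B V).
Let mV : measurable V := let: And3 mV _ _ := hV in mV.
Implicit Types (a b e s : field R d).

Lemma Ck1_cst0 : Ck 1 (cst 0 : Rd -> R).
Proof.
have p0 j : partial j (cst 0 : Rd -> R) = cst 0.
  by apply/funext => x; rewrite /partial derive_cst.
split; first exact: cst_continuous.
by move=> j; split=> [x|]; [exact: derivable_cst|rewrite p0; exact: cst_continuous].
Qed.

Lemma Ck1_weak_partial (w : Rd -> R) : Ck 1 w ->
  H1loc w /\ forall j, L2loc (partial j w) /\ weak_partial j w (partial j w).
Proof.
move=> w1.
have pw j : L2loc (partial j w) /\ weak_partial j w (partial j w).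
  by split; [apply: continuous_L2loc; exact: (w1.2 j).2|exact: weak_partial_Ck1].
split=> //; split; first exact: continuous_L2loc w1.1.
by move=> j; exists (partial j w); [exact: (pw j).1|exact: (pw j).2].
Qed.

(** The displacement P phi e_i, and its strain below. *)
Let w (i : 'I_d) (phi : Rd -> R) (k : 'I_d) : Rd -> R :=
  if k == i then periodize B phi else cst 0.

Let strain i phi : field R d :=
  fun x => \matrix_(k, j) (2^-1 * (partial j (w i phi k) x + partial k (w i phi j) x)).

Let w_Ck1 (M : R) i phi k : Ck 1 phi -> supported_in_cube M phi -> Ck 1 (w i phi k).
Proof.
move=> p1 pM; rewrite /w; case: ifP => _; last exact: Ck1_cst0.
exact: Ck1_periodize pM.
Qed.

Let partial_wE (M : R) i phi k j : Ck 1 phi -> supported_in_cube M phi ->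
  partial j (w i phi k) = if k == i then periodize B (partial j phi) else cst 0.
Proof.
move=> p1 pM; rewrite /w; case: ifP => _; first exact: partial_periodize pM.
by apply/funext => x; rewrite /partial derive_cst.
Qed.

(** The strain of a smooth periodic displacement, with its classical derivatives
    as weak ones. *)
Lemma E0_strain i (phi : Rd -> R) : test_function phi -> E0 B (strain i phi).
Proof.
move=> tphi; have p1 := test_function_Ck1 tphi.
have [M pM] := test_function_supported tphi.
have pL2 k j : L2per B (partial j (w i phi k)).
  split.
    by apply: continuous_L2loc; have [_ /(_ j)[]] := w_Ck1 i k p1 pM.
  rewrite (partial_wE _ _ _ p1 pM) => z; apply: aeW => x _.
  by case: ifP => // _; rewrite periodize_periodic.
split.
  split=> [x|k j]; first by apply/matrixP => k j; rewrite !mxE addrC.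
  under eq_fun do rewrite mxE mulrDr.
  apply: L2per_linear => //.
  have := L2per_linear 2^-1 (pL2 j k) (L2per_cst B 0).
  by under eq_fun do rewrite addr0.
exists (w i phi), (fun k j => partial j (w i phi k)); split.
- move=> k; have [H1 _] := Ck1_weak_partial (w_Ck1 i k p1 pM); split=> // z.
  by apply: aeW => x _; rewrite /w; case: ifP => // _; rewrite periodize_periodic.
- by move=> k j; have [_] := Ck1_weak_partial (w_Ck1 i k p1 pM); exact.
- exact: aeW.
Qed.

(** The pairing of s with the strain of P phi e_i is the average of
    \sum_j s_ij P (d_j phi), as s is symmetric; unfolding the integral over V
    gives the i-th component of the divergence of s tested against phi. *)
Lemma div_free_of_orthogonal s : sym_fields B s ->
  (forall e, E0 B e -> pairing V s e = 0) -> div_free s.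
Proof.
move=> [syms s2] sE0 i phi tphi.
have p1 := test_function_Ck1 tphi; have [M pM] := test_function_supported tphi.
have cP j : continuous (partial j phi) by exact: (p1.2 j).2.
have PM j := supported_partial j pM.
have := sE0 _ (E0_strain i tphi); rewrite /pairing /average.
move/eqP; rewrite mulf_eq0 invr_eq0 (negbTE (cell_fine_neq0 hB hV))/= => /eqP sE.
rewrite -[RHS]sE.
have PL2 j : L2per B (periodize B (partial j phi)).
  split; last by move=> z; apply: aeW => x _; rewrite periodize_periodic.
  by apply: continuous_L2loc; exact: continuous_periodize (cP j) (PM j).
have isP j := L2perM_integrable hB hV (s2 i j) (PL2 j).
transitivity (\int[mu]_(x in V) (\sum_j s x i j * periodize B (partial j phi) x)).
  rewrite (Rintegral_sum hV isP).2; apply: eq_bigr => j _.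
  exact: (integral_periodic_mul hB hV).
apply: eq_Rintegral => x _; rewrite /ddot.
have sC k j : s x k j = s x j k by have /matrixP/(_ j k) := syms x; rewrite mxE.
transitivity (\sum_k \sum_j s x k j * partial j (w i phi k) x).
  rewrite [RHS](bigD1 i)//= [X in _ = _ + X]big1 ?addr0.
    by apply: eq_bigr => j _; rewrite (partial_wE _ _ _ p1 pM) eqxx.
  move=> k ki; rewrite big1// => j _.
  by rewrite (partial_wE _ _ _ p1 pM) (negbTE ki) mulr0.
transitivity (2^-1 * (\sum_k \sum_j s x k j * partial j (w i phi k) x) +
              2^-1 * (\sum_k \sum_j s x k j * partial k (w i phi j) x)).
  rewrite [X in _ = _ + _ * X]exchange_big/=.
  under [X in _ = _ + _ * X]eq_bigr do under eq_bigr do rewrite sC.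
  by lra.
rewrite !mulr_sumr -big_split; apply: eq_bigr => k _ /=.
rewrite !mulr_sumr -big_split; apply: eq_bigr => j _ /=.
by rewrite mxE; ring.
Qed.

Lemma uniform_mean s : sym_fields B s -> uniform B (mean V s).
Proof.
move=> [syms s2].
have meanT : Defs.symmetric (mean V s 0).
  apply/matrixP => i j; rewrite !mxE; congr average; apply/funext => x.
  by have /matrixP/(_ i j) := syms x; rewrite mxE.
split; last by exists (mean V s 0); exact: aeW.
by split=> [x|i j]; [exact: meanT|exact: L2per_field_cst (mean V s 0) i j].
Qed.

Lemma mean_sub_mean s : L2per_field B s ->
  mean V (fun x => s x - mean V s x) = (fun=> 0).
Proof.
move=> s2; apply/funext => y; apply/matrixP => i j; rewrite !mxE.
under [X in average _ X]eq_fun do rewrite !mxE.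
rewrite (averageB hV); first by rewrite (average_cst hB hV) subrr.
  exact: (L2per_integrable hB hV (s2 i j)).
exact: (L2per_integrable hB hV (L2per_cst B _)).
Qed.

Lemma sym_fieldsB a b : sym_fields B a -> sym_fields B b ->
  sym_fields B (fun x => a x - b x).
Proof.
move=> [syma a2] [symb b2]; split=> [x|]; last exact: (L2per_fieldB a2 b2).
by rewrite /Defs.symmetric linearB/= syma symb.
Qed.

(** Subtracting the mean keeps the divergence zero, since the integral of
    d_j phi vanishes. *)
Lemma S_of_orthogonal s : sym_fields B s ->
  (forall e, E0 B e -> pairing V s e = 0) -> Defs.S B V s.
Proof.
move=> ss sE0; have [syms s2] := ss; have um := uniform_mean ss.
exists (mean V s) => //.
exists (fun x => s x - mean V s x); last by apply/funext => x; rewrite addrC subrK.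
split; [exact: sym_fieldsB um.1| |exact: mean_sub_mean].
move=> i phi tphi; rewrite -[RHS](div_free_of_orthogonal ss sE0 i tphi).
apply: eq_bigr => j _.
have p1 := test_function_Ck1 tphi; have [M pM] := test_function_supported tphi.
have PM := supported_partial j pM.
have cP : continuous (partial j phi) by exact: (p1.2 j).2.
under eq_Rintegral do rewrite !mxE mulrBl.
rewrite RintegralB//; first last.
- apply: (L2locM_integrable (M := M)) => //; exact: (L2per_cst B _).1.
- by apply: (L2locM_integrable (M := M)) => //; exact: (s2 i j).1.
rewrite RintegralZl//; last exact: integrable_continuous_supported PM.
by rewrite (Rintegral_partial_eq0 _ p1 pM) mulr0 subr0.
Qed.

End orthogonal_to_strains.

(** * Orthogonal projectors up to null sets *)

Section abstract_projectors.
Context (R : realType) (d : nat) (B : 'M[R]_d).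
Local Notation mu := (lebesgue_rV R d).
Local Notation H := (sym_fields B).
Context (ip : field R d -> field R d -> R).
Implicit Types (a b c eta : field R d) (U W : set (field R d)).
Hypothesis ipC : forall a b, H a -> H b -> ip a b = ip b a.
Hypothesis ipBl : forall a b c, H a -> H b -> H c ->
  ip (fun x => a x - b x) c = ip a c - ip b c.
Hypothesis ip_def : forall a, H a -> ip a a = 0 -> a = (fun=> 0) %[ae mu].

Lemma sym_fields0 : H (fun=> 0).
Proof. by split=> [x|i j]; [exact: trmx0|exact: L2per_field_cst 0 i j]. Qed.

Lemma sym_fieldsD a b : H a -> H b -> H (fun x => a x + b x).
Proof.
move=> Ha Hb; have := sym_fieldsB Ha (sym_fieldsB sym_fields0 Hb).
by under eq_fun do rewrite sub0r opprK.
Qed.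

Lemma ipDl a b c : H a -> H b -> H c ->
  ip (fun x => a x + b x) c = ip a c + ip b c.
Proof.
move=> Ha Hb Hc; apply/eqP; rewrite -subr_eq -ipBl//; last exact: sym_fieldsD.
by apply/eqP; congr ip; apply/funext => x; rewrite addrK.
Qed.

(** The projectors are functions on representatives and only their defining
    property is known, so uniqueness holds almost everywhere: P eta - g is orthogonal
    to W, in particular to P eta and to g, hence to itself. *)
Lemma projector_unique W P eta g : (forall w, W w -> H w) ->
  orthogonal_projector B ip W P -> H eta -> W g ->
  (forall w, W w -> ip (fun x => eta x - g x) w = 0) ->
  P eta = g %[ae mu].
Proof.
move=> WH PW Heta Wg gperp; have [WP Pperp] := PW eta Heta.
have HP := WH _ WP; have Hg := WH _ Wg.
pose del : field R d := fun x => P eta x - g x.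
have Hdel : H del by exact: sym_fieldsB.
have delW w : W w -> ip del w = 0.
  move=> Ww; have Hw := WH _ Ww.
  have -> : del = (fun x => (eta x - g x) - (eta x - P eta x)).
    by apply/funext => x; rewrite /del; apply/matrixP => i j; rewrite !mxE; ring.
  by rewrite ipBl ?gperp ?Pperp ?subrr//; exact: sym_fieldsB.
have := ip_def Hdel; rewrite {1}/del ipBl// ipC// delW// ipC// delW// subrr => /(_ erefl).
by apply: filterS => x /= + _ => /(_ I) /eqP; rewrite subr_eq0 => /eqP.
Qed.

Section decomposition.
Context (U W0 : set (field R d)) (m P0 Pperp : field R d -> field R d).
Hypotheses (UH : forall u, U u -> H u) (WH : forall w, W0 w -> H w).
Hypotheses (U0 : U (fun=> 0)) (W00 : W0 (fun=> 0)).
Hypothesis UW : forall u w, U u -> W0 w -> ip u w = 0.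
Hypothesis mU : forall eta, H eta -> U (m eta).
Hypothesis m_perp : forall eta u, H eta -> U u -> ip (fun x => eta x - m eta x) u = 0.
Hypothesis hP0 : orthogonal_projector B ip W0 P0.
Hypothesis hPperp :
  orthogonal_projector B ip (orthogonal_complement B ip (sum_fields U W0)) Pperp.

(** The remainder r is orthogonal to U and to W0, so it belongs to the orthogonal
    complement of U + W0; it is also orthogonal to this complement, because
    eta - Pperp eta is, hence r is orthogonal to itself. *)
Lemma orthogonal_decomposition eta : H eta ->
  eta = (fun x => m eta x + P0 eta x + Pperp eta x) %[ae mu].
Proof.
move=> He; have [Wp pperp] := hP0 He; have [[Hq qperp] qproj] := hPperp He.
move: (P0 eta) (Pperp eta) Wp pperp Hq qperp qproj => p q Wp pperp Hq qperp qproj.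
have Um := mU He; have Hm := UH Um; have Hp := WH Wp.
have Uin u : U u -> sum_fields U W0 u.
  by move=> Uu; exists u => //; exists (fun=> 0) => //; apply/funext => x; rewrite addr0.
have Win w : W0 w -> sum_fields U W0 w.
  by move=> Ww; exists (fun=> 0) => //; exists w => //; apply/funext => x; rewrite add0r.
have Hmp : H (fun x => m eta x + p x) by exact: sym_fieldsD.
pose r : field R d := fun x => (eta x - q x) - (m eta x + p x).
have Hr : H r by apply: sym_fieldsB => //; exact: sym_fieldsB.
have ru u : U u -> ip r u = 0.
  move=> Uu; have Hu := UH Uu.
  have -> : r = (fun x => (eta x - m eta x) - (p x + q x)).
    by apply/funext => x; rewrite /r; apply/matrixP => i j; rewrite !mxE; ring.
  rewrite ipBl//; [|exact: sym_fieldsB|exact: sym_fieldsD].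
  rewrite m_perp// ipDl// qperp; last exact: Uin.
  by rewrite ipC// UW// addr0 subr0.
have rw w : W0 w -> ip r w = 0.
  move=> Ww; have Hw := WH Ww.
  have -> : r = (fun x => (eta x - p x) - (m eta x + q x)).
    by apply/funext => x; rewrite /r; apply/matrixP => i j; rewrite !mxE; ring.
  rewrite ipBl//; [|exact: sym_fieldsB|exact: sym_fieldsD].
  rewrite pperp// ipDl// qperp; last exact: Win.
  by rewrite UW// addr0 subr0.
have rperp w : sum_fields U W0 w -> ip r w = 0.
  move=> [u Uu [w0 Ww0 <-]]; have [Hu Hw0] := (UH Uu, WH Ww0).
  rewrite ipC//; last exact: sym_fieldsD.
  by rewrite ipDl// -(ipC Hr Hu) -(ipC Hr Hw0) ru// rw// addr0.
have rr : ip r r = 0.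
  rewrite {1}/r ipBl//; last exact: sym_fieldsB.
  rewrite qproj; last by split.
  by rewrite ipC// rperp ?subrr//; exists (m eta) => //; exists p.
apply: filterS (ip_def Hr rr) => x /(_ I)/eqP; rewrite subr_eq0 subr_eq => /eqP -> _ //.
Qed.

End decomposition.

End abstract_projectors.

(** * Energetic scalar products and Hill's lemma *)

Section energetic_products.
Context (R : realType) (d : nat) (B : 'M[R]_d) (V : set 'rV[R]_d) (L0 : tensor4 R d).
Local Notation mu := (lebesgue_rV R d).
Local Notation H := (sym_fields B).
Hypotheses (hB : B \in unitmx) (hV : unit_cell B V).
Hypotheses (minL : minor_symmetries L0) (majL : major_symmetry L0)
  (posL : positive_definite L0).
Let mV : measurable V := let: And3 mV _ _ := hV in mV.
Implicit Types (a b c e s u eta tau : field R d).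

Lemma L2per_field_app (T : tensor4 R d) e : L2per_field B e ->
  L2per_field B (field_app T e).
Proof.
move=> e2 i j.
have := @L2per_sum _ _ B ('I_d * 'I_d)%type (fun p => T i j p.1 p.2)
  (fun p x => e x p.1 p.2) (fun p => e2 p.1 p.2).
by congr (L2per B _); apply/funext => x; rewrite mxE pair_big.
Qed.

Lemma sym_fields_app e : H e -> H (field_app L0 e).
Proof.
move=> [_ e2]; split=> [x|]; first exact: tensor_app_symmetric.
exact: L2per_field_app.
Qed.

Lemma sym_fields_inv s : H s -> H (field_inv L0 s).
Proof.
move=> [ss s2]; have [T TP] := tensor_invP minL posL.
split=> [x|]; first by have [_ []] := TP _ (ss x).
have -> : field_inv L0 s = field_app T s.
  by apply/funext => x; rewrite /field_inv (TP _ (ss x)).1.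
exact: L2per_field_app.
Qed.

Lemma field_invK s : H s -> field_app L0 (field_inv L0 s) = s.
Proof.
move=> [ss _]; have [T TP] := tensor_invP minL posL.
by apply/funext => x; have [_ []] := TP _ (ss x).
Qed.

Lemma field_appK e : H e -> field_inv L0 (field_app L0 e) = e.
Proof.
move=> He; have Hle := sym_fields_app He; have Hile := sym_fields_inv Hle.
apply/funext => x; apply/eqP; rewrite -subr_eq0; apply/eqP.
apply: (tensor_app_inj posL).
  by have [+ _] := sym_fieldsB Hile He; exact.
rewrite tensor_appB; apply/eqP; rewrite subr_eq0; apply/eqP.
by have /(congr1 (fun f => f x)) := field_invK Hle.
Qed.

Lemma pairing_app a b : pairing V (field_app L0 a) b = pairing V a (field_app L0 b).
Proof. by rewrite /pairing; congr average; apply/funext => x; rewrite ddot_tensor_app. Qed.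

Lemma ip_eC a b : ip_e V L0 a b = ip_e V L0 b a.
Proof. by rewrite -![ip_e _ _ _ _]/(pairing _ _ _) pairing_app pairingC. Qed.

Lemma ip_eBl a b c : H a -> H b -> H c ->
  ip_e V L0 (fun x => a x - b x) c = ip_e V L0 a c - ip_e V L0 b c.
Proof.
move=> Ha Hb Hc; rewrite -![ip_e _ _ _ _]/(pairing _ _ _).
rewrite -(pairingBl hB hV (sym_fields_app Ha).2 (sym_fields_app Hb).2 Hc.2).
by congr pairing; apply/funext => x; rewrite /field_app tensor_appB.
Qed.

(** The energy density is nonnegative, so it vanishes almost everywhere on V;
    periodicity carries the conclusion from V to the whole space. *)
Lemma ip_e_def a : H a -> ip_e V L0 a a = 0 -> a = (fun=> 0) %[ae mu].
Proof.
move=> Ha aa0; have [sa a2] := Ha.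
pose h x := ddot (field_app L0 a x) (a x).
have h0 x : 0 <= h x.
  have [ax0|ax0] := eqVneq (a x) 0; last exact: ltW (posL (sa x) ax0).
  rewrite /h ax0 /ddot sumr_ge0// => i _; rewrite sumr_ge0// => j _.
  by rewrite [X in _ * X]mxE mulr0.
have ih : mu.-integrable V (EFin \o h) := ddot_integrable hB hV (sym_fields_app Ha).2 a2.
have /integrableP[mh _] := ih.
have hV0 : ae_eq mu V (EFin \o h) (cst 0%E).
  apply/ae_eq_integral_abs => //.
  under eq_integral do rewrite /= ger0_norm//.
  apply/eqP; rewrite -fine_eq0; last exact: integrable_fin_num ih.
  move/eqP: aa0; rewrite /ip_e /average mulf_eq0 invr_eq0.
  by rewrite (negbTE (cell_fine_neq0 hB hV)).
have aV0 : \forall x \ae mu, V x -> a x = 0.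
  apply: filterS hV0 => x hx Vx; apply/eqP; apply: contraT => /(posL (sa x)).
  have /= /eqP := hx Vx; rewrite eqe => /eqP hx0.
  by rewrite -/(field_app L0 a x) -/(h x) hx0 ltxx.
have aij : \forall x \ae mu, forall p : 'I_d * 'I_d, a x p.1 p.2 = 0.
  apply: ae_forall_countable => -[i j] /=.
  apply: (periodic_ae0 hV) => //; [exact: (a2 i j).1.1|exact: (a2 i j).2|].
  by apply: filterS aV0 => x + Vx => ->//; rewrite mxE.
by apply: filterS aij => x ax _; apply/matrixP => i j; rewrite mxE (ax (i, j)).
Qed.

(** The two energetic spaces are isometric, which reduces symmetry and
    definiteness of [ip_s] to those of [ip_e]. *)
Lemma ip_sE a b : H a -> ip_s V L0 a b = ip_e V L0 (field_inv L0 a) (field_inv L0 b).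
Proof. by move=> Ha; rewrite /ip_e field_invK. Qed.

Lemma field_invB a b : H a -> H b ->
  field_inv L0 (fun x => a x - b x) = (fun x => field_inv L0 a x - field_inv L0 b x).
Proof.
move=> Ha Hb; have [Hia Hib] := (sym_fields_inv Ha, sym_fields_inv Hb).
rewrite -[RHS]field_appK; last exact: sym_fieldsB.
congr field_inv; apply/funext => x; rewrite /field_app tensor_appB.
by rewrite -[in LHS](field_invK Ha) -[in LHS](field_invK Hb).
Qed.

Lemma ip_sC a b : H a -> H b -> ip_s V L0 a b = ip_s V L0 b a.
Proof. by move=> Ha Hb; rewrite !ip_sE// ip_eC. Qed.

Lemma ip_sBl a b c : H a -> H b -> H c ->
  ip_s V L0 (fun x => a x - b x) c = ip_s V L0 a c - ip_s V L0 b c.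
Proof.
move=> Ha Hb Hc; exact: (pairingBl hB hV Ha.2 Hb.2 (sym_fields_inv Hc).2).
Qed.

Lemma ip_s_def a : H a -> ip_s V L0 a a = 0 -> a = (fun=> 0) %[ae mu].
Proof.
move=> Ha; rewrite ip_sE// => /(ip_e_def (sym_fields_inv Ha)).
apply: filterS => x /(_ I) ax _; rewrite -[a](field_invK Ha) /field_app ax.
exact: tensor_app0.
Qed.

Lemma E0_0 : E0 B (fun=> 0 : 'M[R]_d).
Proof.
have [H1 pw] := Ck1_weak_partial (@Ck1_cst0 R d).
split; first exact: sym_fields0.
exists (fun=> cst 0), (fun _ j => partial j (cst 0)); split => //.
- by move=> _; split=> // z; exact: aeW.
- apply: aeW => x _; apply/matrixP => i j; rewrite !mxE /partial.
  by rewrite !derive_cst addr0 mulr0.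
Qed.

Lemma uniform0 : uniform B (fun=> 0 : 'M[R]_d).
Proof. by split; [exact: sym_fields0|exists 0; exact: aeW]. Qed.

Lemma S0_0 : S0 B V (fun=> 0 : 'M[R]_d).
Proof.
split; first exact: sym_fields0.
- move=> i phi _; apply: big1 => j _; rewrite /Rintegral.
  by under eq_integral do rewrite mxE mul0r; rewrite integral0.
- apply/funext => x; apply/matrixP => i j; rewrite !mxE.
  exact: (average_cst hB hV).
Qed.

Lemma uniform_app u : uniform B u -> uniform B (field_app L0 u).
Proof.
move=> [Hu [c uc]]; split; first exact: sym_fields_app.
by exists (tensor_app L0 c); apply: filterS uc => x /= + _ => /(_ I); rewrite /field_app => ->.
Qed.

Lemma uniform_inv u : uniform B u -> uniform B (field_inv L0 u).
Proof.
move=> [Hu [c uc]]; split; first exact: sym_fields_inv.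
by exists (tensor_inv L0 c); apply: filterS uc => x /= + _ => /(_ I); rewrite /field_inv => ->.
Qed.

Lemma pairing_uniform s u : L2per_field B s -> mean V s = (fun=> 0) -> uniform B u ->
  pairing V s u = 0.
Proof.
move=> s2 s0 [Hu [c uc]].
rewrite (pairing_ae hB hV (b := fun=> c) s2 Hu.2 (L2per_field_cst _ _) uc).
exact: (pairing_cst hB hV).
Qed.

Lemma pairing0r s : pairing V s (fun=> 0) = 0.
Proof.
rewrite -[RHS](average_cst hB hV); congr average; apply/funext => x.
by rewrite /ddot big1// => i _; rewrite big1// => j _; rewrite mxE mulr0.
Qed.

Section hill.
Context (P_E0 Gamma0 : field R d -> field R d).
Hypotheses (hPE0 : orthogonal_projector B (ip_e V L0) (E0 B) P_E0)
  (hGamma0 : strain_green_operator B V L0 Gamma0).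

(** Both 0 and the projection p of L^-1 tau onto E0 solve the problem that
    defines Gamma0 tau, for tau = - s, so that p = 0 almost everywhere: this is
    the orthogonality of L^-1 tau to E0. *)
Lemma hill_lemma s e : Defs.S B V s -> E0 B e -> pairing V s e = 0.
Proof.
move=> Ss E0e; have He := E0e.1.
have Hs : H s.
  by have [u [Hu _] [w [Hw _ _] <-]] := Ss; exact: sym_fieldsD.
pose tau : field R d := fun x => 0 - s x.
have Htau : H tau by apply: sym_fieldsB => //; exact: sym_fields0.
have [E0p pperp] := hPE0 (sym_fields_inv Htau).
set p := P_E0 _ in E0p pperp; have Hp := E0p.1; have HLp := sym_fields_app Hp.
have Lp_tau e' : E0 B e' -> pairing V (field_app L0 p) e' = pairing V tau e'.
  move=> E0e'; have := pperp _ E0e'; rewrite ip_eBl//; last 2 first.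
  - exact: sym_fields_inv.
  - exact: E0e'.1.
  by move/eqP; rewrite subr_eq0 /ip_e field_invK// => /eqP.
(* p and 0 solve the problem that defines Gamma0 tau *)
have [_ uniq_tau] := hGamma0 Htau.
have p_sol : p = Gamma0 tau %[ae mu].
  apply: uniq_tau; split => //; apply: (S_of_orthogonal hB hV).
    exact: sym_fieldsB.
  move=> e' E0e'; rewrite (pairingBl hB hV HLp.2 Htau.2 E0e'.1.2).
  by rewrite Lp_tau// subrr.
have zero_sol : (fun=> 0) = Gamma0 tau %[ae mu].
  apply: uniq_tau; split; first exact: E0_0.
  rewrite (_ : (fun x => _) = s)//; apply/funext => x.
  by rewrite /field_app tensor_app0 /tau !sub0r opprK.
have p0 : p = (fun=> 0) %[ae mu].
  by apply: filterS2 p_sol zero_sol => x /= + + _ => /(_ I) -> /(_ I) ->.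
have : pairing V tau e = 0.
  rewrite -Lp_tau// pairing_app pairingC.
  rewrite (pairing_ae hB hV (sym_fields_app He).2 Hp.2 (L2per_field_cst B 0) p0).
  exact: pairing0r.
rewrite (pairingBl hB hV (L2per_field_cst B 0) Hs.2 He.2) [X in X - _]pairingC.
by rewrite pairing0r sub0r => /eqP; rewrite oppr_eq0 => /eqP.
Qed.

End hill.

End energetic_products.

Theorem proposition1 (R : realType) (d : nat)
  (B : 'M[R]_d) (V : set 'rV[R]_d) (L0 : tensor4 R d)
  (hB : B \in unitmx) (hV : unit_cell B V)
  (hminor : minor_symmetries L0) (hmajor : major_symmetry L0)
  (hpos : positive_definite L0)
  (P_E0 P_Eperp P_S0 P_Sperp Gamma0 Delta0 : field R d -> field R d)
  (hPE0 : orthogonal_projector B (ip_e V L0) (E0 B) P_E0)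
  (hPEperp : orthogonal_projector B (ip_e V L0) (E_perp B V L0) P_Eperp)
  (hPS0 : orthogonal_projector B (ip_s V L0) (S0 B V) P_S0)
  (hPSperp : orthogonal_projector B (ip_s V L0) (S_perp B V L0) P_Sperp)
  (hGamma0 : strain_green_operator B V L0 Gamma0)
  (hDelta0 : stress_green_operator B V L0 Delta0) :
  (forall eta : field R d, sym_fields B eta ->
    [/\ eta = (fun x => mean V eta x + P_E0 eta x + P_Eperp eta x)
          %[ae lebesgue_rV R d],
        P_E0 eta = Gamma0 (field_app L0 eta) %[ae lebesgue_rV R d] &
        P_Eperp eta = field_inv L0 (Delta0 eta) %[ae lebesgue_rV R d]]) /\
  (forall tau : field R d, sym_fields B tau ->
    [/\ tau = (fun x => mean V tau x + P_S0 tau x + P_Sperp tau x)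
          %[ae lebesgue_rV R d],
        P_S0 tau = Delta0 (field_inv L0 tau) %[ae lebesgue_rV R d] &
        P_Sperp tau = field_app L0 (Gamma0 tau) %[ae lebesgue_rV R d]]).
Proof.
have hill := hill_lemma hB hV hminor hmajor hpos hPE0 hGamma0.
have eC a b (_ : sym_fields B a) (_ : sym_fields B b) := ip_eC V hmajor a b.
have eB := ip_eBl hB hV hminor.
have edef := ip_e_def hB hV hminor hpos.
have sC a b (Ha : sym_fields B a) (Hb : sym_fields B b) :=
  ip_sC V hminor hmajor hpos Ha Hb.
have sB := ip_sBl hB hV hminor hpos.
have sdef := ip_s_def hB hV hminor hpos.
have HE0 w : E0 B w -> sym_fields B w by case.
have HS0 w : S0 B V w -> sym_fields B w by case.
have HU w : uniform B w -> sym_fields B w by case.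
have Z0 := uniform0 B.
have SU u : uniform B u -> Defs.S B V u.
  move=> Uu; exists u => //; exists (fun=> 0); first exact: S0_0.
  by apply/funext => x; rewrite addr0.
have SS0 s : S0 B V s -> Defs.S B V s.
  by move=> Ss; exists (fun=> 0) => //; exists s => //; apply/funext => x; rewrite add0r.
have US0 u s : uniform B u -> S0 B V s -> pairing V s u = 0.
  by move=> Uu [Hs _ s0]; exact: (pairing_uniform hB hV Hs.2 s0 Uu).
have E_S0 e s : Defs.E B e -> S0 B V s -> pairing V s e = 0.
  move=> [u Uu [w E0w <-]] Ss; have Hs := HS0 _ Ss.
  rewrite pairingC (ipDl (ip := pairing V) (B := B))//;
    [|move=> a b c Ha Hb Hc|exact: HU|exact: HE0].
    by rewrite pairingC US0// pairingC hill ?addr0//; exact: SS0.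
  exact: (pairingBl hB hV Ha.2 Hb.2 Hc.2).
have UE0 u e : uniform B u -> E0 B e -> ip_e V L0 u e = 0.
  move=> Uu E0e; rewrite /ip_e -/(pairing V _ _); apply: hill => //.
  by apply: SU; exact: uniform_app.
have US u s : uniform B u -> S0 B V s -> ip_s V L0 u s = 0.
  move=> Uu Ss; rewrite sC//; [|exact: HU|exact: HS0].
  by apply: US0 => //; exact: uniform_inv.
have mean_perp eta u : sym_fields B eta -> uniform B u ->
    pairing V (fun x => eta x - mean V eta x) u = 0.
  move=> He Uu; have Hm := (uniform_mean V He).1.
  apply: (pairing_uniform hB hV (sym_fieldsB He Hm).2 _ Uu).
  exact: (mean_sub_mean hB hV He.2).
split=> [eta Heta|tau Htau].
- have [E0g Sg] := (hGamma0 _ (sym_fields_app hminor Heta)).1.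
  have [S0s Es] := (hDelta0 _ Heta).1.
  have Hg := HE0 _ E0g; have Hs := HS0 _ S0s; have His := sym_fields_inv hminor hpos Hs.
  split.
  + apply: (orthogonal_decomposition eC eB edef HU HE0 Z0 (E0_0 B) UE0 _ _ hPE0 hPEperp Heta).
      by move=> e; exact: uniform_mean.
    move=> e u He Uu; rewrite /ip_e -/(pairing V _ _) pairing_app//.
    by apply: mean_perp => //; exact: uniform_app.
  + apply: (projector_unique eC eB edef HE0 hPE0 Heta E0g) => w E0w.
    have Hw := HE0 _ E0w.
    have := hill _ _ Sg E0w; rewrite (pairingBl hB hV (sym_fields_app hminor Hg).2
      (sym_fields_app hminor Heta).2 Hw.2) => /eqP; rewrite subr_eq0 => /eqP gw.
    by rewrite eB//; apply/eqP; rewrite subr_eq0; apply/eqP/esym.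
  + apply: (projector_unique eC eB edef _ hPEperp Heta) => [w []//||w [Hw wE]].
      split=> // w Ew; rewrite /ip_e -/(pairing V _ _) (field_invK hminor hpos Hs).
      exact: E_S0.
    have := wE _ Es; rewrite eC//; last exact: sym_fieldsB.
    rewrite eB// => /eqP; rewrite subr_eq0 => /eqP gw.
    by rewrite eB// gw subrr.
- have [S0s Es] := (hDelta0 _ (sym_fields_inv hminor hpos Htau)).1.
  have [E0g Sg] := (hGamma0 _ Htau).1.
  have Hg := HE0 _ E0g; have Hs := HS0 _ S0s; have HLg := sym_fields_app hminor Hg.
  split.
  + apply: (orthogonal_decomposition sC sB sdef HU HS0 Z0 (S0_0 hB hV) US _ _ hPS0 hPSperp Htau).
      by move=> e; exact: uniform_mean.
    by move=> e u He Uu; apply: mean_perp => //; exact: uniform_inv.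
  + apply: (projector_unique sC sB sdef HS0 hPS0 Htau S0s) => w S0w.
    have Hw := HS0 _ S0w.
    have : ip_s V L0 w (fun x => Delta0 (field_inv L0 tau) x - tau x) = 0.
      rewrite /ip_s -/(pairing V _ _) (field_invB hminor hpos Hs Htau).
      exact: E_S0.
    rewrite sC//; last exact: sym_fieldsB.
    rewrite sB// => /eqP; rewrite subr_eq0 => /eqP gw.
    by rewrite sB// gw subrr.
  + apply: (projector_unique sC sB sdef _ hPSperp Htau) => [w []//||w [Hw wS]].
      split=> // w Sw.
      have Hw : sym_fields B w.
        by have [u [Hu _] [v [Hv _ _] <-]] := Sw; exact: sym_fieldsD.
      rewrite sC// /ip_s -/(pairing V _ _) (field_appK hminor hpos Hg).
      exact: hill.
    have := wS _ Sg; rewrite sC//; last exact: sym_fieldsB.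
    rewrite sB// => /eqP; rewrite subr_eq0 => /eqP gw.
    by rewrite sB// gw subrr.
Qed.
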